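(* There exist absolute constants $c>0$ and $C\ge 0$ such that for every finite set $A\subset\mathbb{C}$ with $|A|\ge 2$ the following four inequalities hold: \begin{align*} |A-A|+|A:A| &\ge c\,|A|^{1+\frac{9}{31}}(\log|A|)^{-C},\\ |A+A|+|A:A| &\ge c\,|A|^{1+\frac{15}{53}}(\log|A|)^{-C},\\ |A-A|+|A\cdot A| &\ge c\,|A|^{1+\frac{11}{39}}(\log|A|)^{-C},\\ |A+A|+|A\cdot A| &\ge c\,|A|^{1+\frac{19}{69}}(\log|A|)^{-C}. \end{align*}
   Context: For a finite set $A\subset\mathbb{C}$: $A+A=\{a_1+a_2: a_1,a_2\in A\}$, $A-A=\{a_1-a_2: a_1,a_2\in A\}$, $A\cdot A=\{a_1a_2: a_1,a_2\in A\}$, and $A:A=\{a_1/a_2: a_1,a_2\in A,\ a_2\neq 0\}$. The paper writes these bounds as $\gg |A|^{1+\alpha-o(1)}$, where the $o(1)$ in the exponent absorbs factors polylogarithmic in $|A|$ and $\gg$ hides an absolute constant; this is what the claim expresses. *)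

(* Defs.v *)
From mathcomp Require Import all_boot all_order all_algebra finmap.
From mathcomp Require Import complex.
From mathcomp Require Import reals exp.

Set Implicit Arguments.
Unset Strict Implicit.
Unset Printing Implicit Defensive.

Local Open Scope fset_scope.
Local Open Scope ring_scope.

Definition sumset (F : fieldType) (A : {fset F}) : {fset F} :=
  [fset x + y | x in A, y in A].

Definition diffset (F : fieldType) (A : {fset F}) : {fset F} :=
  [fset x - y | x in A, y in A].

Definition prodset (F : fieldType) (A : {fset F}) : {fset F} :=
  [fset x * y | x in A, y in A].

Definition ratioset (F : fieldType) (A : {fset F}) : {fset F} :=
  [fset x / y | x in A, y in A & y != 0].

(* Main.v *)
(* Szemeredi-Trotter for complex Cartesian products: if a line y = m x + b has
   k >= 2 points in X * Y, join each of them to its nearest neighbour on the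
   line.  Affine maps of the complex line are similarities, so the two
   projections of this pair are nearest neighbours as well, and since a point
   lies in boundedly many nearest-neighbour discs, for at least k/3 of the pairs
   the two projections have ranks O(|X|/k) and O(|Y|/k).  Such a pair determines
   the line, hence there are O(|X|^2 |Y|^2 / k^3) lines with at least k points.

   Write n = |A|, D = A - A, r(s) for the number of representations of s as a
   difference, A_s = A cap (A + s), D_s = D cap (D - s), and ignore logarithms.
   (1) Since A - A_s is contained in D_s (Schoen-Shkredov, Katz-Koester),
   Cauchy-Schwarz and Holder give n^8 <= |D| E_3(A) E(A,D).  With P = A : A,
   incidences of lines of slope in A^-1 with P * D give
   E(A,D)^2 << |P|^2 |D|^3; counting the pairs of points of S * S and A * A,
   S = {s : r(s) >= t}, on lines with slope in P gives
   t^3 |S| << |P|^(3/4) n^(5/2).  Hence n^22 << |D|^10 |P|^7, and 22/17 > 40/31.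
   (2), (4) If nn(m) is the ratio nearest to m among those with at least t
   representations, then the slopes of the sums of a point of slope m and one of
   slope nn(m) lie in a disc around m, and these discs overlap boundedly (in the
   spirit of Solymosi and of Konyagin-Rudnev); so the multiplicative energy is
   << |A + A|^2, which gives the exponent 4/3.
   (3) Let T be the set of ratios m with at least t representations, N = |T|,
   A_m = {a in A : ma in A}.  Third moments on lines with slope in T
   bound from above both the sum of |D_{s,s'}| |D_{ms,ms'}| over (m, s, s') by
   |D|^4 and the square sum of the number q of triples a, a + s, a + s' in A_m by
   n^4; the q^2 points of (A_m)_{s,s'} * m(A_m)_{s,s'} span at least
   N min(q^2, N) / 2 lines with slope in T, each with t points in
   D_{s,s'} * D_{ms,ms'}, which bounds |D_{s,s'}| |D_{ms,ms'}| from below.  With a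
   dyadic t this gives n^18 << |AA|^6 |D|^8 or n^4 << |AA|^3, and
   min(18/14, 4/3) > 50/39. *)

Require Import Defs.
From mathcomp Require Import all_boot all_order all_algebra finmap.
From mathcomp Require Import complex.
From mathcomp Require Import reals exp.
From mathcomp Require boolp.
From mathcomp Require Import zify ring lra.

Set Implicit Arguments.
Unset Strict Implicit.
Unset Printing Implicit Defensive.

Import Order.TTheory GRing.Theory Num.Theory.

(** * Finite sums and complex discs *)

Lemma sum_eq_mem (T : eqType) (s : seq T) (y : T) :
  uniq s -> \sum_(x <- s) (x == y) = (y \in s).
Proof.
by move=> us; rewrite -big_mkcond sum1_count /= count_uniq_mem.
Qed.

Lemma sum_mem_size (T : eqType) (s : seq T) (P : pred T) :
  \sum_(x <- s) P x = size (filter P s).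
Proof. by rewrite -big_mkcond sum1_count size_filter. Qed.

Lemma sum_nat_const_seq (T : Type) (s : seq T) (c : nat) :
  \sum_(x <- s) c = size s * c.
Proof. by rewrite big_const_seq count_predT iter_addn_0 mulnC. Qed.

Lemma leq_sum_seq_in (T : eqType) (s : seq T) (f g : T -> nat) :
  {in s, forall x, f x <= g x} -> \sum_(x <- s) f x <= \sum_(x <- s) g x.
Proof.
by move=> h; rewrite big_seq [leqRHS]big_seq; apply: leq_sum => x /h.
Qed.

Lemma eq_sum_seq_in (T : eqType) (s : seq T) (f g : T -> nat) :
  {in s, forall x, f x = g x} -> \sum_(x <- s) f x = \sum_(x <- s) g x.
Proof. by move=> h; rewrite big_seq [RHS]big_seq; apply: eq_bigr => x /h. Qed.

Lemma size_inj_leq (T U : eqType) (s : seq T) (t : seq U) (f : T -> U) :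
  uniq s -> {in s &, injective f} -> {in s, forall x, f x \in t} ->
  size s <= size t.
Proof.
move=> us fi ft; rewrite -(size_map f); apply: uniq_leq_size.
  by rewrite map_inj_in_uniq.
by move=> y /mapP[x /ft xs ->].
Qed.

Lemma mem_tail (T : eqType) (y x : T) (s : seq T) : x \in s -> x \in y :: s.
Proof. by rewrite inE orbC => ->. Qed.

Lemma sqr_leq (x y : nat) : x ^ 2 <= y ^ 2 -> x <= y.
Proof. by rewrite leq_exp2r. Qed.

(** The termwise hypothesis avoids square roots in [nat]; in the induction the cross term $2xy \le
    pq'+p'q$ is AM-GM. *)
Lemma cauchy_schwarz (T : eqType) (s : seq T) (u a b : T -> nat) :
  {in s, forall i, u i ^ 2 <= a i * b i} ->
  (\sum_(i <- s) u i) ^ 2 <= (\sum_(i <- s) a i) * (\sum_(i <- s) b i).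
Proof.
elim: s => [|i s IHs] h; first by rewrite !big_nil.
rewrite !big_cons.
have h1 : u i ^ 2 <= a i * b i by apply: h; rewrite mem_head.
have {IHs h}h2 := IHs (fun j js => h j (mem_tail i js)).
move: (u i) (a i) (b i) h1 (\sum_(j <- s) u j) (\sum_(j <- s) a j)
  (\sum_(j <- s) b j) h2 => x p q hx y p' q' hy.
have h : 2 * (x * y) <= p * q' + p' * q.
  apply: sqr_leq.
  have -> : (2 * (x * y)) ^ 2 = 4 * (x ^ 2 * y ^ 2) by ring.
  apply: leq_trans (nat_AGM2 (p * q') (p' * q)).
  rewrite leq_pmul2l //; apply: leq_trans (leq_mul hx hy) _.
  by rewrite leq_eqVlt; apply/orP; left; apply/eqP; ring.
have -> : (x + y) ^ 2 = x ^ 2 + y ^ 2 + 2 * (x * y) by ring.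
have -> : (p + p') * (q + q') = p * q + p' * q' + (p * q' + p' * q) by ring.
by rewrite leq_add // leq_add.
Qed.

Lemma AGM3 (p q r : nat) : 27 * (p * q * r) <= (p + q + r) ^ 3.
Proof.
have C12 (x y z : nat) :
    (27 * (x * y * z) <= (x + y + z) ^ 3) = (27 * (y * x * z) <= (y + x + z) ^ 3).
  by rewrite [x * y]mulnC [x + y]addnC.
have C23 (x y z : nat) :
    (27 * (x * y * z) <= (x + y + z) ^ 3) = (27 * (x * z * y) <= (x + z + y) ^ 3).
  by rewrite mulnAC addnAC.
have inc (x y z : nat) : x <= y -> y <= z ->
    27 * (x * y * z) <= (x + y + z) ^ 3.
  (* With [a], [b] the two gaps, the difference of the sides is $9x(a^2+ab+b^2)+(2a+b)^3$; the other
     orderings follow by symmetry. *)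
  move=> xy yz; have -> : y = x + (y - x) by lia.
  have -> : z = x + (y - x) + (z - y) by lia.
  by move: (y - x) (z - y) => a b; nia.
have [pq|/ltnW qp] := leqP p q; have [qr|/ltnW rq] := leqP q r;
  have [pr|/ltnW rp] := leqP p r.
- exact: inc.
- exact: inc.
- by rewrite C23 inc.
- by rewrite C23 C12 inc.
- by rewrite C12 inc.
- by rewrite C12 C23 inc.
- by rewrite C12 C23 C12 inc.
- by rewrite C12 C23 C12 inc.
Qed.

(** Induction as for Cauchy-Schwarz: by [AGM3], a mixed term $3z^2t$ is at most the sum of three
    terms whose product is $(PQR)^2P'Q'R'$. *)
Lemma holder3 (T : eqType) (s : seq T) (u a b c : T -> nat) :
  {in s, forall i, u i ^ 3 <= a i * b i * c i} ->
  (\sum_(i <- s) u i) ^ 3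
    <= (\sum_(i <- s) a i) * (\sum_(i <- s) b i) * (\sum_(i <- s) c i).
Proof.
elim: s => [|i s IHs] h; first by rewrite !big_nil.
rewrite !big_cons.
have h1 : u i ^ 3 <= a i * b i * c i by apply: h; rewrite mem_head.
have {IHs h}h2 := IHs (fun j js => h j (mem_tail i js)).
move: (u i) (a i) (b i) (c i) h1 (\sum_(j <- s) u j) (\sum_(j <- s) a j)
  (\sum_(j <- s) b j) (\sum_(j <- s) c j) h2 => x p q r hx y p' q' r' hy.
have H (z t P Q R P' Q' R' : nat) : z ^ 3 <= P * Q * R ->
    t ^ 3 <= P' * Q' * R' ->
    3 * (z ^ 2 * t) <= P * Q * R' + P * Q' * R + P' * Q * R.
  move=> hz ht; rewrite -(leq_exp2r _ _ (isT : 0 < 3)).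
  apply: leq_trans (AGM3 _ _ _).
  have := leq_mul (leq_mul hz hz) ht; lia.
have := H _ _ _ _ _ _ _ _ hx hy; have := H _ _ _ _ _ _ _ _ hy hx; lia.
Qed.

(** * Discs and nearest neighbours in the complex plane *)

Section Plane.
Variable R : realType.
Local Open Scope ring_scope.
Local Notation C := R[i].
Implicit Types (z w : C).

(** The squared modulus as an element of [R]: distances compare in an ordered field, without square
    roots. *)
Definition nsq z : R := complex.Re z ^+ 2 + complex.Im z ^+ 2.

Lemma nsqM z w : nsq (z * w) = nsq z * nsq w.
Proof. by case: z w => [a b] [c d]; rewrite /nsq /=; ring. Qed.

Lemma nsqN z : nsq (- z) = nsq z.
Proof. by case: z => a b; rewrite /nsq /= !sqrrN. Qed.

Lemma nsqB z w : nsq (z - w) = nsq (w - z).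
Proof. by rewrite -nsqN opprB. Qed.

Lemma nsq_ge0 z : 0 <= nsq z.
Proof. by rewrite addr_ge0 ?sqr_ge0. Qed.

Lemma nsq_eq0 z : (nsq z == 0) = (z == 0).
Proof.
case: z => a b; rewrite /nsq /= paddr_eq0 ?sqr_ge0 // !sqrf_eq0.
by rewrite eq_complex.
Qed.

(** The last three flags cut the plane into eight sectors of 45 degrees; the first singles out 0. *)
Definition octant z : bool * bool * bool * bool :=
  (z == 0, 0 <= complex.Re z, 0 <= complex.Im z,
   complex.Re z ^+ 2 <= complex.Im z ^+ 2).

(** Vectors of one octant make an angle of at most 45 degrees, so $|z|\,|w| \le \sqrt2\,\langle
    z,w\rangle$; for $|z|\le|w|$ this gives $|z|^2 < 2\langle z,w\rangle$. *)
Lemma octant_close z w : z != 0 -> octant z = octant w ->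
  nsq z <= nsq w -> nsq (w - z) < nsq w.
Proof.
case: z w => [x y] [x' y'] z0 [_ hx hy hxy].
have : 0 < nsq (x +i* y)%C by rewrite lt0r nsq_eq0 z0 nsq_ge0.
rewrite /nsq /= => p0 pq.
have sg (a b : R) : (0 <= a) = (0 <= b) -> 0 <= a * b.
  case: (leP 0 a) => [a0 /esym b0|a0 /esym]; first by rewrite mulr_ge0.
  by move/negbT; rewrite -ltNge => b0; rewrite nmulr_rge0 // ltW.
have hxx := sg _ _ hx; have hyy := sg _ _ hy.
have hs : 0 <= (y ^+ 2 - x ^+ 2) * (y' ^+ 2 - x' ^+ 2).
  by apply: sg; rewrite !subr_ge0.
set p := _ + _ in p0 pq *; set q := x' ^+ 2 + _ in pq *.
pose c := x * x' + y * y'.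
have c0 : 0 <= c by rewrite addr_ge0.
(* Indeed $2c^2-pq = (y^2-x^2)(y'^2-x'^2)+4xx'yy'$, and both terms are nonnegative. *)
have hc : 2 * p * q <= 4 * c ^+ 2 by rewrite /p /q /c; nra.
have -> : (x' + - x) ^+ 2 + (y' + - y) ^+ 2 = p + q - 2 * c.
  by rewrite /p /q /c; ring.
suff : p < 2 * c by lra.
rewrite -(ltr_pXn2r (isT : (0 < 2)%N)) ?nnegrE ?(ltW p0) ?mulr_ge0 //.
nra.
Qed.

(* At most one point of [T] per octant around [p] can have [p] in its disc,
   plus possibly [p] itself. *)
Lemma kissing (T : seq C) (rho : C -> R) (p : C) : uniq T ->
  {in T &, forall a b, a != b -> rho a <= nsq (b - a)} ->
  (\sum_(a <- T) (nsq (p - a) <= rho a)%R <= 16)%N.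
Proof.
move=> uT hrho; rewrite sum_mem_size.
set U := filter _ _.
have -> : 16%N = size (enum {: bool * bool * bool * bool}).
  by rewrite -cardE !card_prod card_bool.
apply: (@size_inj_leq _ _ _ _ (fun a => octant (a - p))).
- exact: filter_uniq.
- suff H (a b : C) : a \in U -> b \in U -> nsq (a - p) <= nsq (b - p) ->
    octant (a - p) = octant (b - p) -> a = b.
    move=> a b aU bU h; case: (leP (nsq (a - p)) (nsq (b - p))) => [/H|/ltW/H].
      exact.
    by move=> /(_ bU aU (esym h)).
  rewrite !mem_filter => /andP[_ aT] /andP[pb bT] ab o.
  apply/eqP/negPn/negP => neq.
  have [a0|a0] := eqVneq (a - p) 0.
    have /eqP b0 : b - p == 0 by case: o => <- _ _ _; rewrite a0.
    by case/eqP: neq; rewrite -(subrK p a) -(subrK p b) a0 b0.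
  (* This gives $|b-a|<|b-p|$, against $|b-p|^2\le$ [rho b] $\le|b-a|^2$. *)
  have := octant_close a0 o ab.
  rewrite opprB addrA subrK ltNge => /negP; apply.
  rewrite nsqB (nsqB b a); apply: le_trans pb _; apply: hrho => //.
  by rewrite eq_sym.
- by move=> a _; rewrite mem_enum.
Qed.

Lemma argmin_seq (T : eqType) (s : seq T) (f : T -> R) (x0 : T) : x0 \in s ->
  exists2 x, x \in s & {in s, forall y, f x <= f y}.
Proof.
elim: s x0 => // y s IHs x0 _.
case: s IHs => [|z s] IHs.
  by exists y; rewrite ?inE // => t; rewrite inE => /eqP->.
have [x xs hx] := IHs z (mem_head _ _).
have [h|/ltW h] := leP (f x) (f y).
  exists x; first exact: mem_tail.
  by move=> t; rewrite inE => /predU1P[->|/hx].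
exists y; first exact: mem_head.
move=> t; rewrite inE => /predU1P[->|/hx] //; exact: le_trans.
Qed.

Lemma argmax_seq (T : eqType) (s : seq T) (f : T -> R) (x0 : T) : x0 \in s ->
  exists2 x, x \in s & {in s, forall y, f y <= f x}.
Proof.
move=> /(@argmin_seq _ s (fun x => - f x))[x xs h]; exists x => // y /h.
by rewrite lerN2.
Qed.

Lemma nearest_neighbour (T : seq C) : uniq T -> (1 < size T)%N ->
  exists nn : C -> C, {in T, forall a, [/\ nn a \in T, nn a != a
    & {in T, forall b, b != a -> nsq (nn a - a) <= nsq (b - a)}]}.
Proof.
move=> uT sT.
have H a : exists b, a \in T -> [/\ b \in T, b != a
    & {in T, forall c, c != a -> nsq (b - a) <= nsq (c - a)}].
  case: (boolP (a \in T)) => [aT|]; last by exists a.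
  have : (0 < size (filter (predC1 a) T))%N.
    rewrite size_filter.
    by move: sT; rewrite -(count_predC (pred1 a)) count_uniq_mem // aT.
  case E: (filter _ T) => [|x0 s] // _.
  have : x0 \in filter (predC1 a) T by rewrite E mem_head.
  case/(argmin_seq (fun b => nsq (b - a))) => b.
  rewrite mem_filter /= => /andP[ba bT] hb; exists b => _; split=> // c cT ca.
  by apply: hb; rewrite mem_filter /= ca.
by have [nn h] := boolp.choice H; exists nn => a /h.
Qed.

(* All counted points lie in the disc of the farthest one, even with ties. *)
Lemma low_rank_bound (X : seq C) (f : C -> R) (k M : nat) :
  (k * \sum_(y <- X) (k * \sum_(x <- X) (f x <= f y)%R <= M) <= M)%N.
Proof.
rewrite sum_mem_size; set S := filter _ _.
case ES: S => [|y0 S0]; first by rewrite muln0.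
rewrite -ES; have : y0 \in S by rewrite ES mem_head.
case/(argmax_seq f) => y; rewrite mem_filter => /andP[hy yX] hmax.
apply: leq_trans hy; rewrite leq_mul2l; apply/orP; right.
rewrite size_filter -sum1_count big_mkcond /=.
rewrite [leqRHS](eq_bigr (fun x => if f x <= f y then 1%N else 0%N)); last first.
  by move=> x _; case: ifP.
apply: leq_sum_seq_in => x xX; case: ifP => // hx.
by rewrite hmax // mem_filter hx.
Qed.

(** After exchanging the sums, [kissing] bounds the number of discs containing each [g x]. The map
    [g] lets points of the other projection be pulled back. *)
Lemma sum_disc_bound (T X : seq C) (nn : C -> C) (g : C -> C) : uniq T ->
  {in T &, forall a b, a != b -> nsq (nn a - a) <= nsq (b - a)} ->
  (\sum_(a <- T) \sum_(x <- X) (nsq (g x - a) <= nsq (nn a - a))%R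
     <= 16 * size X)%N.
Proof.
move=> uT h; rewrite exchange_big mulnC -sum_nat_const_seq.
apply: leq_sum => x _.
exact: (@kissing _ (fun a => nsq (nn a - a))).
Qed.

(** Markov's inequality: at most $k/3$ elements have weight above $3M/k$, so two such exceptional
    sets still spare a third of [k]. *)
Lemma markov_count (T : seq C) (w : C -> nat) (k M : nat) :
  (\sum_(a <- T) w a <= M)%N -> (0 < M)%N ->
  (3 * \sum_(a <- T) (3 * M < k * w a) <= k)%N.
Proof.
move=> hM M0; rewrite -(leq_pmul2l M0) mulnCA mulnA [(3 * M)%N]mulnC -mulnA.
apply: (@leq_trans (k * \sum_(a <- T) w a)); last by rewrite mulnC leq_mul2r hM orbT.
rewrite mulnA big_distrr big_distrr /=; apply: leq_sum => a _.
by case: ltnP; lia.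
Qed.

End Plane.

Definition incid (F : fieldType) (X Y : seq F) (l : F * F) : nat :=
  \sum_(x <- X) ((l.1 * x + l.2)%R \in Y).

(** Szemeredi-Trotter as a property of the field, with lines encoded as (slope, intercept). The
    value $k=1$ is excluded: over an infinite field infinitely many lines pass through one point. *)
Definition rich_lines_bound (F : fieldType) (K : nat) :=
  forall (X Y : seq F) (s : seq (F * F)) (k : nat),
    uniq X -> uniq Y -> uniq s -> 1 < k ->
    {in s, forall l, l.1 != 0%R /\ k <= incid X Y l} ->
    k ^ 3 * size s <= K * (size X ^ 2 * size Y ^ 2).

(** * Rich lines of a Cartesian product *)

Lemma mem_pairs (T U : eqType) (s : seq T) (t : seq U) (x : T) (y : U) :
  ((x, y) \in [seq (a, b) | a <- s, b <- t]) = (x \in s) && (y \in t).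
Proof.
apply/allpairsP/andP => [[[a b] /= [hs ht [-> ->]]] //|[hs ht]].
by exists (x, y).
Qed.

(** For each of the two projections [markov_count] discards at most $k/3$ points of the line. *)
Lemma good_points (R : realType) (X Y : seq R[i]) (l : R[i] * R[i])
    (nn : R[i] -> R[i]) (k : nat) (phi := fun x => (l.1 * x + l.2)%R)
    (T := filter (fun x => phi x \in Y) X) :
  uniq X -> l.1 != 0%R -> 0 < k <= incid X Y l ->
  {in T &, forall a b, a != b -> nsq (nn a - a) <= nsq (b - a)}%R ->
  k <= 3 * \sum_(a <- T)
    ((k * \sum_(x <- X) (nsq (x - a) <= nsq (nn a - a))%R <= 3 * (16 * size X))
    && (k * \sum_(y <- Y) (nsq (y - phi a) <= nsq (phi (nn a) - phi a))%R
          <= 3 * (16 * size Y))).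
Proof.
move=> uX l0 /andP[k0 kl] hnn; have uT : uniq T by exact: filter_uniq.
have sT : size T = incid X Y l by rewrite /incid sum_mem_size.
have [a0 a0T] : exists a0, a0 \in T.
  by case: (T) sT (leq_trans k0 kl) => [<- //|a0 ? _ _]; exists a0; rewrite mem_head.
have X0 : 0 < 16 * size X.
  by move: a0T; rewrite mem_filter => /andP[_]; case: (X).
have Y0 : 0 < 16 * size Y.
  by move: a0T; rewrite mem_filter => /andP[+ _]; case: (Y).
have hX : 3 * \sum_(a <- T) (3 * (16 * size X) <
      k * \sum_(x <- X) (nsq (x - a) <= nsq (nn a - a))%R) <= k.
  exact: (markov_count k (sum_disc_bound X id uT hnn) X0).
have : \sum_(a <- T) \sum_(y <- Y)
    (nsq (y - phi a) <= nsq (phi (nn a) - phi a))%R <= 16 * size Y.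
  (* The affine map [phi] scales squared distances by [nsq l.1], so discs of the second projection
     pull back to discs of the first. *)
  rewrite (eq_bigr (fun a => \sum_(y <- Y)
      (nsq ((y - l.2) / l.1 - a) <= nsq (nn a - a))%R)) ?sum_disc_bound // => a _.
  apply: eq_bigr => y _; congr nat_of_bool.
  have -> : (y - phi a = l.1 * ((y - l.2) / l.1 - a))%R by rewrite /phi; field.
  have -> : (phi (nn a) - phi a = l.1 * (nn a - a))%R by rewrite /phi; ring.
  by rewrite !nsqM ler_pM2l // lt0r nsq_eq0 l0 nsq_ge0.
move=> /(markov_count k)/(_ Y0) hY.
set g := BIG_F.
suff : size T <= \sum_(a <- T) g a
    + \sum_(a <- T) (3 * (16 * size X) <
        k * \sum_(x <- X) (nsq (x - a) <= nsq (nn a - a))%R)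
    + \sum_(a <- T) (3 * (16 * size Y) <
        k * \sum_(y <- Y) (nsq (y - phi a) <= nsq (phi (nn a) - phi a))%R).
  rewrite sT; have lin (u v w z : nat) :
    3 * u <= k -> 3 * v <= k -> k <= z -> z <= w + u + v -> k <= 3 * w.
    by lia.
  exact: lin hX hY kl.
rewrite -!big_split /= -[leqLHS]muln1 -sum_nat_const_seq.
have cover (a b c d : nat) : 0 < ((a <= b) && (c <= d)) + (b < a) + (d < c).
  by case: (leqP a b); case: (leqP c d).
by apply: leq_sum => a _; exact: cover.
Qed.

Lemma close_pairs (R : realType) (X : seq R[i]) (k M : nat) :
  k * size [seq p <- [seq (a, a') | a <- X, a' <- X] |
     k * \sum_(x <- X) (nsq (x - p.1) <= nsq (p.2 - p.1))%R <= M]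
  <= size X * M.
Proof.
rewrite -sum_mem_size big_allpairs big_distrr /= -sum_nat_const_seq.
apply: leq_sum => a _; exact: (low_rank_bound X (fun x => nsq (x - a)%R)).
Qed.

(** Good incidences (line, point) inject into pairs of close pairs, one per coordinate. The constant
    is 3, for the third of the points kept, times $48=3\cdot16$ per coordinate, from Markov and
    [kissing]. *)
Theorem complex_rich_lines (R : realType) :
  rich_lines_bound R[i] (3 * 48 ^ 2).
Proof.
move=> X Y s k uX uY us k1 hs.
pose phi (l : R[i] * R[i]) x := (l.1 * x + l.2)%R.
pose T l := filter (fun x => phi l x \in Y) X.
have [NN hNN] : exists NN, forall l, l \in s -> {in T l, forall a,
    [/\ NN l a \in T l, NN l a != a
      & {in T l, forall b, b != a -> nsq (NN l a - a) <= nsq (b - a)}]}%R.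
  suff H l : exists nn, l \in s -> {in T l, forall a, [/\ nn a \in T l, nn a != a
      & {in T l, forall b, b != a -> nsq (nn a - a) <= nsq (b - a)}]}%R.
    by have [NN] := boolp.choice H; exists NN.
  case: (boolP (l \in s)) => [ls|_]; last by exists id.
  have [nn h] := @nearest_neighbour R (T l) (filter_uniq _ uX)
    (leq_trans k1 (leq_trans (hs l ls).2 (eq_leq (sum_mem_size _ _)))).
  by exists nn.
pose disc (Z : seq R[i]) a a' :=
  k * \sum_(x <- Z) (nsq (x - a) <= nsq (a' - a))%R <= 3 * (16 * size Z).
pose good (p : R[i] * R[i] * R[i]) := [&& p.2 \in T p.1, disc X p.2 (NN p.1 p.2)
  & disc Y (phi p.1 p.2) (phi p.1 (NN p.1 p.2))].
pose G := filter good [seq (l, a) | l <- s, a <- X].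
pose Q (Z : seq R[i]) := filter (fun p => disc Z p.1 p.2)
  [seq (a, a') | a <- Z, a' <- Z].
have sG : k * size s <= 3 * size G.
  rewrite /G -sum_mem_size big_allpairs big_distrr /= mulnC -sum_nat_const_seq.
  apply: leq_sum_seq_in => l ls; have [l0 kl] := hs _ ls.
  apply: leq_trans (@good_points R X Y l (NN l) k uX l0 _ _) _.
  - by rewrite kl ltnW.
  - move=> a b /(hNN _ ls)[_ _ h] bT ab; apply: h => //; by rewrite eq_sym.
  - rewrite leq_mul2l /= big_filter big_mkcond /=.
    apply: leq_sum_seq_in => a aX; rewrite /good /= mem_filter aX andbT.
    by case: ifP => // ->.
have sQ : size G <= size (Q X) * size (Q Y).
  rewrite -(size_allpairs pair); apply: (@size_inj_leq _ _ _ _ (fun p =>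
    ((p.2, NN p.1 p.2), (phi p.1 p.2, phi p.1 (NN p.1 p.2))))).
  - by apply: filter_uniq; apply: allpairs_uniq => // -[l a] [l' a'].
  - move=> [l a] [l' a']; rewrite !mem_filter !mem_pairs /=.
    move=> /andP[/and3P[/= aT _ _]] /andP[ls _] _ [ea en eb ebn].
    move: eb ebn; rewrite -en -ea => eb ebn.
    have [_ neq _] := hNN _ ls _ aT; congr pair; move: {aT} neq.
    move: (NN l a) eb ebn => b; rewrite /phi {ea en ls}.
    case: l l' => [m c] [m' c'] /= e e' ne.
    (* Lines that agree at the distinct abscissae [a] and [b] have equal slopes, hence equal
       intercepts. *)
    have e1 : ((m - m') * (b - a) = 0)%R.
      transitivity ((m * b + c - (m * a + c)) - (m' * b + c' - (m' * a + c')))%R.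
        ring.
      by rewrite e e' subrr.
    have /eqP : (m - m' == 0)%R.
      by move/eqP: e1; rewrite mulf_eq0 [(b - _ == 0)%R]subr_eq0 (negbTE ne) orbF.
    move=> /subr0_eq em; subst m'; congr pair.
    exact: addrI e.
  - move=> [l a]; rewrite mem_filter mem_pairs /=.
    move=> /andP[/and3P[/= aT d1 d2] /andP[ls _]].
    have [nT _ _] := hNN _ ls _ aT.
    move: aT nT; rewrite !mem_filter => /andP[aY aX] /andP[nY nX].
    by rewrite mem_pairs !mem_filter /= d1 d2 !mem_pairs aX nX aY nY.
have hX := close_pairs X k (3 * (16 * size X)).
have hY := close_pairs Y k (3 * (16 * size Y)).
rewrite -/(Q X) -/(Q Y) in hX hY.
apply: (@leq_trans (3 * (k * size (Q X)) * (k * size (Q Y)))).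
  have -> : k ^ 3 * size s = k ^ 2 * (k * size s) by ring.
  have -> : 3 * (k * size (Q X)) * (k * size (Q Y))
    = k ^ 2 * (3 * (size (Q X) * size (Q Y))) by ring.
  rewrite leq_mul2l; apply/orP; right; apply: leq_trans sG _.
  by rewrite leq_mul2l.
apply: leq_trans (leq_mul (leq_mul (leqnn 3) hX) hY) _.
by rewrite leq_eqVlt; apply/orP; left; apply/eqP; ring.
Qed.

(** * Third moments and the Katz-Koester inclusion *)

(** Dyadic decomposition: [r i] is charged to the level $2^j\le r_i<2^{j+1}$, which costs $2^p$, and
    there are [L] levels. *)
Lemma layer_cake (T : eqType) (s : seq T) (r : T -> nat) (p L M : nat) :
  0 < p -> {in s, forall i, r i < 2 ^ L} ->
  (forall t, 0 < t -> t ^ p * \sum_(i <- s) (t <= r i) <= M) ->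
  \sum_(i <- s) r i ^ p <= 2 ^ p * (L * M).
Proof.
move=> p0 hr hM.
apply: (@leq_trans (\sum_(i <- s) 2 ^ p * \sum_(j < L) (2 ^ j) ^ p * (2 ^ j <= r i))).
  apply: leq_sum_seq_in => i /hr; case: (posnP (r i)) => [->|r0 rL].
    by rewrite exp0n.
  have [lo hi] := andP (trunc_log_bounds (isT : 1 < 2) r0).
  have jL : trunc_log 2 (r i) < L.
    by rewrite -(ltn_exp2l _ _ (isT : 1 < 2)) (leq_ltn_trans lo).
  rewrite (bigD1 (Ordinal jL)) //= lo muln1 mulnDr.
  apply: leq_trans (leq_addr _ _); rewrite -expnMn -expnS leq_exp2r //.
  exact: ltnW.
rewrite -big_distrr leq_mul2l /= exchange_big /=; apply/orP; right.
apply: (@leq_trans (\sum_(j < L) M)); last by rewrite sum_nat_const card_ord.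
apply: leq_sum => j _; rewrite -big_distrr /=; apply: hM.
by rewrite expn_gt0.
Qed.

Lemma count_inj_leq (T U : eqType) (s : seq T) (t : seq U) (P : pred T)
    (Q : pred U) (f : T -> U) : uniq s -> injective f ->
  {in s, forall x, P x -> (f x \in t) && Q (f x)} ->
  \sum_(x <- s) P x <= \sum_(y <- t) Q y.
Proof.
move=> us fi h; rewrite !sum_mem_size; apply: (@size_inj_leq _ _ _ _ f).
- exact: filter_uniq.
- by move=> x y _ _ /fi.
- by move=> x; rewrite !mem_filter => /andP[Px /h/(_ Px)/andP[-> ->]].
Qed.

Lemma regroup2 (T U V : eqType) (X : seq T) (Y : seq U) (Z : seq V)
    (h : T -> U -> V) (g : V -> nat) : uniq Z ->
  {in X & Y, forall x y, h x y \in Z} ->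
  \sum_(x <- X) \sum_(y <- Y) g (h x y)
    = \sum_(z <- Z) (\sum_(x <- X) \sum_(y <- Y) (h x y == z)) * g z.
Proof.
move=> uZ hZ; under [RHS]eq_bigr do rewrite big_distrl.
rewrite [RHS]exchange_big; apply: eq_sum_seq_in => x xX.
under [RHS]eq_bigr do rewrite big_distrl.
rewrite [RHS]exchange_big; apply: eq_sum_seq_in => y yY /=.
have -> : g (h x y) = \sum_(z <- Z) (z == h x y) * g (h x y).
  by rewrite -big_distrl /= sum_eq_mem // hZ // mul1n.
by apply: eq_bigr => z _; rewrite eq_sym; case: eqP => // ->.
Qed.

Lemma rich_index (F : fieldType) (K : nat) (T : eqType) (X Y : seq F)
    (s : seq T) (f : T -> F * F) (k : nat) :
  rich_lines_bound F K -> uniq X -> uniq Y -> uniq s -> 1 < k ->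
  {in s &, injective f} ->
  {in s, forall i, (f i).1 != 0%R /\ k <= incid X Y (f i)} ->
  k ^ 3 * size s <= K * (size X ^ 2 * size Y ^ 2).
Proof.
move=> hK uX uY us k1 fi hf; rewrite -(size_map f); apply: hK => //.
  by rewrite map_inj_in_uniq.
by move=> l /mapP[i /hf hi ->].
Qed.

(** This is [layer_cake] with $p=3$, fed by the rich-line bound. The first sum pays for the values
    at most 1, which that bound does not cover. *)
Lemma third_moment (F : fieldType) (K L : nat) (T : eqType) (X Y : seq F)
    (s : seq T) (f : T -> F * F) (r : T -> nat) :
  rich_lines_bound F K -> uniq X -> uniq Y -> uniq s -> 0 < L ->
  {in s &, injective f} ->
  {in s, forall i, [/\ (f i).1 != 0%R, r i <= incid X Y (f i) & r i < 2 ^ L]} ->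
  \sum_(i <- s) r i ^ 3
    <= \sum_(i <- s) r i + 8 * (L * (K * (size X ^ 2 * size Y ^ 2))).
Proof.
move=> hK uX uY us L0 fi hf.
pose r' i := if r i <= 1 then 0 else r i.
apply: (@leq_trans (\sum_(i <- s) (r i + r' i ^ 3))).
  by apply: leq_sum => i _; rewrite /r'; case: (r i) => [|[|n]] //; rewrite leq_addl.
rewrite big_split leq_add2l /=.
apply: (@layer_cake _ _ _ 3) => // [i /hf[_ _]|t t0].
  by rewrite /r'; case: ifP => // _ _; rewrite expn_gt0.
(* Since [r'] never equals 1, the levels 1 and 2 select the same elements; [maxn t 2] meets the
   requirement $1<k$. *)
apply: (@leq_trans (maxn t 2 ^ 3 * size (filter (fun i => maxn t 2 <= r i) s))).
  rewrite -sum_mem_size leq_mul ?leq_exp2r ?leq_maxl //.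
  by apply: leq_sum => i _; rewrite /r' geq_max; case: ifP; case: leqP; lia.
apply: (rich_index hK uX uY (filter_uniq _ us) _ (f := f)).
- by rewrite leq_maxr.
- by move=> i j; rewrite !mem_filter => /andP[_ ?] /andP[_ ?]; exact: fi.
- by move=> i; rewrite mem_filter => /andP[h /hf[? hw _]]; rewrite (leq_trans h).
Qed.

Section KatzKoester.
Variables (V : zmodType) (A D S : seq V).
Hypotheses (uA : uniq A) (uD : uniq D) (uS : uniq S).
Hypothesis AD : {in A & A, forall a b, (a - b)%R \in D}.
Hypothesis AS : {in A & D, forall a d, (a + d)%R \in S}.

Definition diff_rep (d : V) : nat := \sum_(a <- A) ((a - d)%R \in A).
Definition sum_rep (x : V) : nat := \sum_(a <- A) ((x - a)%R \in D).

Lemma regroup_diff (g : V -> nat) :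
  \sum_(a <- A) \sum_(b <- A) g (a - b)%R = \sum_(d <- D) diff_rep d * g d.
Proof.
rewrite (regroup2 g uD AD); apply: eq_bigr => d _; congr muln.
apply: eq_bigr => a _; rewrite -(sum_eq_mem _ uA); apply: eq_bigr => b _.
by rewrite subr_eq [in RHS]eq_sym subr_eq addrC.
Qed.

Lemma regroup_sum (g : V -> nat) :
  \sum_(a <- A) \sum_(d <- D) g (a + d)%R = \sum_(x <- S) sum_rep x * g x.
Proof.
rewrite (regroup2 g uS AS); apply: eq_bigr => x _; congr muln.
apply: eq_bigr => a _; rewrite -(sum_eq_mem _ uD); apply: eq_bigr => d _.
by rewrite [in RHS]eq_sym subr_eq eq_sym addrC.
Qed.

Lemma sum_diff_rep : \sum_(d <- D) diff_rep d = size A ^ 2.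
Proof.
transitivity (\sum_(d <- D) diff_rep d * 1).
  by under eq_bigr do rewrite -[diff_rep _]muln1.
by rewrite -(regroup_diff (fun=> 1)) !sum_nat_const_seq muln1 mulnn.
Qed.

Lemma sum_sum_rep : \sum_(x <- S) sum_rep x = size A * size D.
Proof.
transitivity (\sum_(x <- S) sum_rep x * 1).
  by under eq_bigr do rewrite -[sum_rep _]muln1.
by rewrite -(regroup_sum (fun=> 1)) !sum_nat_const_seq muln1.
Qed.

(** With $A_s=A\cap(A+s)$, these are $|D\cap(D-s)|$ and the additive energy of the pair
    $(A_s,A)$. *)
Let D_ s := \sum_(d <- D) ((d + s)%R \in D).
Let e_ s := \sum_(b <- A) \sum_(b' <- A)
  ((b - s)%R \in A) * (((b' - s)%R \in A) * diff_rep (b - b')%R).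

(* Differences [a - b] with [b] and [b - s] in [A] lie in [D] together with
   their translate by [s]. *)
Lemma katz_koester s : (size A * diff_rep s) ^ 2 <= D_ s * e_ s.
Proof.
(* Here [c z] counts the representations $z=a-b$ with $a\in A$, $b\in A_s$; its second moment is at
   most [e_ s]. *)
pose c z := \sum_(b <- A) ((b - s)%R \in A) * ((z + b)%R \in A).
apply: (@leq_trans ((\sum_(z <- D) ((z + s)%R \in D) * c z) ^ 2)).
  rewrite leq_exp2r //.
  have -> : \sum_(z <- D) ((z + s)%R \in D) * c z = \sum_(b <- A)
      ((b - s)%R \in A) * \sum_(z <- D) (((z + s)%R \in D) && ((z + b)%R \in A)).
    under eq_bigr do rewrite big_distrr.
    rewrite exchange_big; apply: eq_bigr => b _ /=; rewrite big_distrr /=.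
    by apply: eq_bigr => z _; rewrite -mulnb mulnCA.
  rewrite big_distrr /=; apply: leq_sum_seq_in => b bA.
  case: (boolP (b - s \in A)%R) => bsA; last by rewrite muln0.
 rewrite muln1 mul1n.
  rewrite -sum1_size.
  apply: (@count_inj_leq _ _ _ _ xpredT _ (fun a => (a - b)%R)) => //.
    by move=> x y /addIr.
  move=> a aA _; rewrite AD // subrK aA andbT.
  have -> : (a - b + s = a - (b - s))%R by rewrite opprB addrA addrAC.
  exact: AD.
apply: leq_trans (cauchy_schwarz (a := fun z => (z + s \in D)%R : nat)
  (b := fun z => c z ^ 2) _) _.
  by move=> z _ /=; case: (_ \in _); rewrite ?mul1n.
rewrite leq_mul2l /e_; apply/orP; right.
under eq_bigr do rewrite /c -mulnn big_distrlr.
rewrite exchange_big; apply: leq_sum => b _ /=.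
rewrite exchange_big; apply: leq_sum => b' _ /=.
under eq_bigr do rewrite mulnACA -mulnA.
rewrite -!big_distrr !leq_mul //=.
apply: (@leq_trans (\sum_(z <- D) (((z + b)%R \in A) && ((z + b')%R \in A)))).
  by apply: leq_sum => z _; rewrite mulnb.
apply: (@count_inj_leq _ _ _ _ _ _ (fun z => (z + b)%R)) => // [x y /addIr //|z _].
by move=> /andP[-> h]; rewrite opprB addrACA subrr addr0.
Qed.

(** For fixed [b], [b'], at most [diff_rep (b - b')] shifts [s] keep both $b-s$ and $b'-s$ in
    [A]. *)
Lemma sum_local_energy :
  \sum_(s <- D) e_ s <= \sum_(d <- D) diff_rep d ^ 3.
Proof.
under [leqRHS]eq_bigr do rewrite expnS.
rewrite -regroup_diff exchange_big; apply: leq_sum => b _ /=.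
rewrite exchange_big; apply: leq_sum => b' _ /=.
under eq_bigr do rewrite mulnA mulnb.
rewrite -big_distrl expnS expn1 leq_mul2r /=; apply/orP; right.
apply: (@count_inj_leq _ _ _ _ _ _ (fun s => (b - s)%R)) => //.
  by move=> x y /addrI/oppr_inj.
by move=> s _ /andP[-> h]; rewrite opprB addrC addrA subrK.
Qed.

(** Each configuration gives an additive quadruple $b+d=(b-s)+(d+s)$. *)
Lemma sum_local_doubling :
  \sum_(s <- D) D_ s * diff_rep s <= \sum_(x <- S) sum_rep x ^ 2.
Proof.
under [leqRHS]eq_bigr do rewrite expnS expn1.
rewrite -regroup_sum; under eq_bigr do rewrite big_distrlr.
rewrite exchange_big /= [leqRHS]exchange_big /=; apply: leq_sum => d _ /=.
rewrite exchange_big; apply: leq_sum => b _ /=.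
under eq_bigr do rewrite mulnb andbC.
apply: (@count_inj_leq _ _ _ _ _ _ (fun s => (b - s)%R)) => //.
  by move=> x y /addrI/oppr_inj.
by move=> s _ /andP[-> h]; rewrite opprB addrC addrA subrK addrC.
Qed.

(** Multiplying [katz_koester] by $n\,r(s)$ bounds $(n\,r(s))^3$ by a product of three functions of
    [s]. Holder applies to $\sum_s n\,r(s)=n^3$, and one factor $n$ cancels. *)
Lemma energy_lower_bound : size A ^ 8
  <= size D * (\sum_(d <- D) diff_rep d ^ 3) * (\sum_(x <- S) sum_rep x ^ 2).
Proof.
case: (posnP (size A)) => [->|A0] //.
rewrite -(leq_pmul2l A0) -expnS.
have -> : size A ^ 9 = (\sum_(s <- D) size A * diff_rep s) ^ 3.
  by rewrite -big_distrr /= sum_diff_rep; ring.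
apply: leq_trans (holder3 (a := fun=> size A) (b := e_)
  (c := fun s => D_ s * diff_rep s) _) _.
  move=> s _ /=; have := katz_koester s.
  move: (diff_rep s) (D_ s) (e_ s) => x y z h.
  have -> : (size A * x) ^ 3 = (size A * x) ^ 2 * (size A * x) by ring.
  have -> : size A * z * (y * x) = y * z * (size A * x) by ring.
  by rewrite leq_mul2r h orbT.
have := leq_mul sum_local_energy sum_local_doubling.
rewrite sum_nat_const_seq -!mulnA [size D * (size A * _)]mulnCA => h.
exact: (leq_mul (leqnn _) (leq_mul (leqnn _) h)).
Qed.

End KatzKoester.

(** For every [u], a representation $x=a+d$ puts the point $(ua,d)$ of $P\times D$ on the line of
    slope $-1/u$ and intercept [x]. *)
Lemma sum_rep_third_moment (F : fieldType) (K L : nat) (A D S P U : seq F) :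
  rich_lines_bound F K -> uniq A -> uniq D -> uniq S -> uniq P -> uniq U ->
  {in A & D, forall a d, (a + d)%R \in S} ->
  {in U & A, forall u a, (u * a)%R \in P} -> 0%R \notin U ->
  0 < L -> size A < 2 ^ L ->
  size U * \sum_(x <- S) sum_rep A D x ^ 3
    <= size U * (size A * size D) + 8 * (L * (K * (size P ^ 2 * size D ^ 2))).
Proof.
move=> hK uA uD uS uP uU AS UP U0 L0 AL.
rewrite -(sum_sum_rep uD uS AS) -!sum_nat_const_seq -!(big_allpairs (r1 := U) (r2 := S)
  (F := fun i => sum_rep A D i.2 ^ _)) -!(big_allpairs (r1 := U) (r2 := S)
  (F := fun i => sum_rep A D i.2)).
apply: (third_moment hK uP uD _ L0 (f := fun i => (- i.1^-1, i.2)%R)).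
- by apply: allpairs_uniq => // -[a b] [c d].
- by move=> [u x] [v y] _ _ [/oppr_inj/invr_inj -> ->].
move=> [u x]; rewrite mem_pairs /= => /andP[uU' _].
have u0 : u != 0%R by apply: contraNneq U0 => <-.
split; first by rewrite oppr_eq0 invr_eq0.
  apply: (@count_inj_leq _ _ _ _ _ _ (fun a => (u * a)%R)) => //.
    exact: mulfI.
  by move=> a aA h; rewrite UP //= mulNr mulKf // addrC.
by apply: leq_ltn_trans AL; rewrite /sum_rep sum_mem_size size_filter count_size.
Qed.

(** Cauchy-Schwarz between the first and third moments of [sum_rep]; the linear term of the latter
    is absorbed through $|A|\le|P|$. *)
Lemma energy_upper_bound (F : fieldType) (K L : nat) (A D S P U : seq F) :
  rich_lines_bound F K -> uniq A -> uniq D -> uniq S -> uniq P -> uniq U ->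
  {in A & D, forall a d, (a + d)%R \in S} ->
  {in U & A, forall u a, (u * a)%R \in P} -> 0%R \notin U ->
  0 < L -> size A < 2 ^ L -> size U = size A -> 0 < size A ->
  (\sum_(x <- S) sum_rep A D x ^ 2) ^ 2
    <= (8 * K).+1 * (L * (size P ^ 2 * size D ^ 3)).
Proof.
move=> hK uA uD uS uP uU AS UP U0 L0 AL sU A0.
have AP : size A <= size P.
  have : 0 < size U by rewrite sU.
  case EU: U => [//|u U'] _.
  have u0 : u != 0%R by apply: contraNneq U0 => <-; rewrite EU mem_head.
  apply: (@size_inj_leq _ _ _ _ (fun a => (u * a)%R)) => // [a b _ _ /(mulfI u0)//|a aA].
  by rewrite UP // EU mem_head.
have := sum_rep_third_moment hK uA uD uS uP uU AS UP U0 L0 AL; rewrite sU.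
set E3 := \sum_(x <- S) _ => hE3.
have : (\sum_(x <- S) sum_rep A D x ^ 2) ^ 2 <= size A * size D * E3.
  rewrite -(sum_sum_rep uD uS AS); apply: cauchy_schwarz => x _.
  by rewrite -expnS -expnM.
move=> /leq_trans; apply; rewrite [size A * size D]mulnC -mulnA.
apply: (leq_trans (leq_mul (leqnn _) hE3)).
move: (size A) (size D) (size P) AP L0 => n d p np L0.
have h1 : n * (n * d) <= L * (p ^ 2 * d ^ 2).
  case: d => [|d]; first by rewrite !muln0.
  apply: leq_trans (leq_pmull _ L0); rewrite mulnA expnS expn1 leq_mul //.
    by rewrite leq_mul.
  by rewrite expnS expn1 leq_pmulr.
have -> : (8 * K).+1 * (L * (p ^ 2 * d ^ 3))
  = d * (L * (p ^ 2 * d ^ 2) + 8 * (L * (K * (p ^ 2 * d ^ 2)))) by ring.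
by rewrite leq_mul2l leq_add2r h1 orbT.
Qed.

(** * Differences and ratios *)

Lemma incid_pairs (F : fieldType) (X Y : seq F) (l : F * F) : uniq Y ->
  incid X Y l = \sum_(p <- [seq (x, y) | x <- X, y <- Y]) (p.2 == l.1 * p.1 + l.2)%R.
Proof.
move=> uY; rewrite big_allpairs /incid; apply: eq_bigr => x _ /=.
by rewrite sum_eq_mem.
Qed.

Lemma sum_incid_leq (F : fieldType) (X Y P B : seq F) : uniq B ->
  \sum_(l <- [seq (m, b) | m <- P, b <- B]) incid X Y l
    <= size P * (size X * size Y).
Proof.
move=> uB; rewrite big_allpairs -sum_nat_const_seq; apply: leq_sum => m _.
rewrite exchange_big -sum_nat_const_seq; apply: leq_sum => x _ /=.
rewrite -sum1_size.
apply: (@count_inj_leq _ _ _ _ _ xpredT (fun b => (m * x + b)%R)) => //.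
  exact: addrI.
by move=> b _ ->.
Qed.

Lemma incid_leq_size (F : fieldType) (X Y : seq F) (l : F * F) :
  incid X Y l <= size X.
Proof. by rewrite /incid sum_mem_size size_filter count_size. Qed.

Lemma incid_third_moment (F : fieldType) (K L : nat) (X Y P B : seq F) :
  rich_lines_bound F K -> uniq X -> uniq Y -> uniq P -> uniq B -> 0 < L ->
  size X < 2 ^ L -> 0%R \notin P ->
  \sum_(l <- [seq (m, b) | m <- P, b <- B]) incid X Y l ^ 3
    <= size P * (size X * size Y) + 8 * (L * (K * (size X ^ 2 * size Y ^ 2))).
Proof.
move=> hK uX uY uP uB L0 XL P0.
apply: leq_trans (third_moment (f := id) hK uX uY _ L0 _ _) _.
- by apply: allpairs_uniq => // -[a b] [c d].
- by move=> ? ? _ _.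
- move=> [m b]; rewrite mem_pairs => /andP[mP _]; split=> //.
    by apply: contraNneq P0 => <-.
  by apply: leq_ltn_trans XL; exact: incid_leq_size.
- by rewrite leq_add2r sum_incid_leq.
Qed.

(** Cauchy-Schwarz with weight [g], then Holder on $f^2g$. *)
Lemma weighted_holder (T : eqType) (s : seq T) (f g : T -> nat) :
  (\sum_(i <- s) f i * g i) ^ 6
    <= (\sum_(i <- s) g i) ^ 3 * (\sum_(i <- s) f i ^ 3) ^ 2 * \sum_(i <- s) g i ^ 3.
Proof.
have h1 : (\sum_(i <- s) f i * g i) ^ 2
    <= (\sum_(i <- s) g i) * \sum_(i <- s) f i ^ 2 * g i.
  by apply: cauchy_schwarz => i _; apply: eq_leq; ring.
have h2 : (\sum_(i <- s) f i ^ 2 * g i) ^ 3 <=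
   (\sum_(i <- s) f i ^ 3) * (\sum_(i <- s) f i ^ 3) * (\sum_(i <- s) g i ^ 3).
  by apply: holder3 => i _; apply: eq_leq; ring.
rewrite (expnM _ 2 3); apply: leq_trans (_ : _ <= _ ^ 3) _.
  by rewrite leq_exp2r; last by []; exact: h1.
by rewrite expnMn -mulnA leq_mul2l -[_ ^ 2]mulnn h2 orbT.
Qed.

(** After Cauchy-Schwarz, each second moment is interpolated between the first and the third. *)
Lemma fourth_holder (T : eqType) (s : seq T) (f g : T -> nat) :
  (\sum_(i <- s) f i * g i) ^ 4
    <= (\sum_(i <- s) f i) * (\sum_(i <- s) f i ^ 3)
       * ((\sum_(i <- s) g i) * \sum_(i <- s) g i ^ 3).
Proof.
have h (w : T -> nat) : (\sum_(i <- s) w i ^ 2) ^ 2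
    <= (\sum_(i <- s) w i) * \sum_(i <- s) w i ^ 3.
  by apply: cauchy_schwarz => i _; apply: eq_leq; ring.
have h1 : (\sum_(i <- s) f i * g i) ^ 2
    <= (\sum_(i <- s) f i ^ 2) * \sum_(i <- s) g i ^ 2.
  by apply: cauchy_schwarz => i _; apply: eq_leq; ring.
rewrite (expnM _ 2 2); apply: leq_trans (leq_mul (h f) (h g)).
by rewrite -expnMn leq_exp2r.
Qed.

Section RatioSet.
Variables (F : fieldType) (K L : nat) (A P : seq F).
Hypotheses (hK : rich_lines_bound F K) (uA : uniq A) (uP : uniq P).
Hypotheses (A0 : 0%R \notin A) (P0 : 0%R \notin P).
Hypothesis AP : {in A & A, forall a b, (a / b)%R \in P}.
Hypotheses (L0 : 0 < L) (AL : size A < 2 ^ L).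
Hypothesis sP : size P <= size A ^ 2.

Local Notation n := (size A).
Local Notation K1 := (8 * K).+1.

(** If $y-s$ and $y'-s'$ lie in [A], the line through $(s,s')$ and $(y,y')$ has slope
    $(y'-s')/(y-s)\in P$. The squared sum of [diff_rep] counts such configurations. *)
Lemma popular_diff_incid (S : seq F) (t : nat)
    (B := undup [seq (y - q.1 * q.2)%R | q <- [seq (m, x) | m <- P, x <- A], y <- A]) :
  uniq S -> {in S, forall s, t <= diff_rep A s} ->
  (t * size S) ^ 2 <= \sum_(l <- [seq (m, b) | m <- P, b <- B])
    incid S S l * incid A A l.
Proof.
move=> uS hS.
apply: (@leq_trans ((\sum_(s <- S) diff_rep A s) ^ 2)).
  rewrite leq_exp2r // mulnC -sum_nat_const_seq.
  exact: leq_sum_seq_in.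
pose SS := [seq (x, y) | x <- S, y <- S].
pose AA := [seq (x, y) | x <- A, y <- A].
have -> : (\sum_(s <- S) diff_rep A s) ^ 2 = \sum_(p <- SS) \sum_(q <- AA)
    ((q.1 - p.1)%R \in A) * ((q.2 - p.2)%R \in A).
  rewrite -mulnn big_distrlr big_allpairs /=; apply: eq_bigr => s _.
  apply: eq_bigr => s' _ /=; rewrite /diff_rep big_distrlr big_allpairs /=.
  by [].
under [leqRHS]eq_bigr do rewrite !(incid_pairs _ _ uS) !(incid_pairs _ _ uA) big_distrlr.
rewrite [leqRHS]exchange_big; apply: leq_sum => -[s s'] _ /=.
rewrite [leqRHS]exchange_big; apply: leq_sum_seq_in => -[y y'] /=.
rewrite mem_pairs => /andP[yA y'A].
case: (boolP (y - s \in A)%R) => //= ys; case: (boolP (y' - s' \in A)%R) => //= ys'.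
pose m := ((y' - s') / (y - s))%R; pose b := (y' - m * y)%R.
have ys0 : (y - s != 0)%R by apply: contraNneq A0 => <-.
have mP : m \in P by exact: AP.
have lB : (m, b) \in [seq (m, b) | m <- P, b <- B].
  rewrite mem_pairs mP mem_undup; apply/allpairsP; exists ((m, y), y') => /=.
  by rewrite mem_pairs mP yA.
rewrite (big_rem _ lB) /=; apply: leq_trans (leq_addr _ _).
have -> : (s' == m * s + b)%R.
  apply/eqP; rewrite /b; have -> : (y' = m * (y - s) + s')%R.
    by rewrite /m divfK // subrK.
  by ring.
by rewrite /b addrC subrK eqxx.
Qed.

(** The third moment on $S\times S$ is governed by $|S|^4$ if $|P|\le|S|^2$ and by $|P||S|^2$
    otherwise; [weighted_holder] serves the first regime, [fourth_holder] the second. *)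
Lemma popular_diff_bound (S : seq F) (t : nat) :
  uniq S -> size S < 2 ^ L -> {in S, forall s, t <= diff_rep A s} ->
  t ^ 12 * size S ^ 4 <= K1 ^ 3 * (L ^ 3 * (size P ^ 3 * n ^ 10)).
Proof.
move=> uS SL hS.
have [S0|S0] := posnP (size S); first by rewrite S0 muln0.
have tn : t <= n.
  have [s sS] : exists s, s \in S by case: (S) S0 => // s ? _; exists s; rewrite mem_head.
  apply: leq_trans (hS s sS) _.
  by rewrite /diff_rep sum_mem_size size_filter count_size.
have := popular_diff_incid uS hS; set B := undup _.
have uB : uniq B by exact: undup_uniq.
have hf1 := @sum_incid_leq F S S P B uB.
have hg1 := @sum_incid_leq F A A P B uB.
have hf3 := incid_third_moment hK uS uS uP uB L0 SL P0.
have hg3 := incid_third_moment hK uA uA uP uB L0 AL P0.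
set Om := [seq _ | _ <- _, _ <- _] in hf1 hg1 hf3 hg3 *.
have H6 := weighted_holder Om (incid S S) (incid A A).
have H4 := fourth_holder Om (incid S S) (incid A A).
move: (\sum_(l <- Om) _ * _) H6 H4 => X H6 H4 hX.
have {}hg3 : \sum_(l <- Om) incid A A l ^ 3 <= K1 * (L * n ^ 4).
  apply: leq_trans hg3 _.
  have : size P * (n * n) <= L * n ^ 4.
    apply: leq_trans (leq_pmull _ L0).
    have -> : n ^ 4 = n ^ 2 * (n * n) by ring.
    by rewrite leq_mul.
  by move: (size P) n; lia.
have {}hg1 : \sum_(l <- Om) incid A A l <= size P * n ^ 2 by rewrite -mulnn.
have {}hf1 : \sum_(l <- Om) incid S S l <= size P * size S ^ 2 by rewrite -mulnn.
have [PS|SP] := leqP (size P) (size S ^ 2).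
  have {}hf3 : \sum_(l <- Om) incid S S l ^ 3 <= K1 * (L * size S ^ 4).
    apply: leq_trans hf3 _.
    have : size P * (size S * size S) <= L * size S ^ 4.
      apply: leq_trans (leq_pmull _ L0).
      have -> : size S ^ 4 = size S ^ 2 * (size S * size S) by ring.
      by rewrite leq_mul.
    by move: (size P) (size S); lia.
  have S8 : 0 < size S ^ 8 by rewrite expn_gt0 S0.
  rewrite -(leq_pmul2l S8).
  have -> : size S ^ 8 * (t ^ 12 * size S ^ 4) = ((t * size S) ^ 2) ^ 6 by ring.
  have hX6 : ((t * size S) ^ 2) ^ 6 <= X ^ 6 by rewrite leq_exp2r.
  apply: leq_trans hX6 _; apply: leq_trans H6 _.
  apply: (@leq_trans ((size P * n ^ 2) ^ 3 * (K1 * (L * size S ^ 4)) ^ 2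
     * (K1 * (L * n ^ 4)))).
    by rewrite !leq_mul // leq_exp2r.
  by apply: eq_leq; ring.
have {}hf3 : \sum_(l <- Om) incid S S l ^ 3 <= K1 * (L * (size P * size S ^ 2)).
  apply: leq_trans hf3 _.
  have h1 : size P * (size S * size S) <= L * (size P * size S ^ 2).
    by rewrite mulnn leq_pmull.
  have h2 : K * (size S ^ 2 * size S ^ 2) <= K * (size P * size S ^ 2).
    by rewrite leq_mul2l leq_mul2r (ltnW SP) !orbT.
  have -> : K1 * (L * (size P * size S ^ 2))
    = L * (size P * size S ^ 2) + 8 * (L * (K * (size P * size S ^ 2))) by ring.
  by rewrite leq_add // leq_mul2l leq_mul2l h2 !orbT.
(* [fourth_holder] yields only $t^8$; the missing $t^4$ is paid by $t\le n$. *)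
have S4 : 0 < size S ^ 4 by rewrite expn_gt0 S0.
rewrite -(leq_pmul2l S4).
have -> : size S ^ 4 * (t ^ 12 * size S ^ 4) = t ^ 4 * ((t * size S) ^ 2) ^ 4 by ring.
have hX4 : ((t * size S) ^ 2) ^ 4 <= X ^ 4 by rewrite leq_exp2r.
apply: (@leq_trans (n ^ 4 * (size P * size S ^ 2 * (K1 * (L * (size P * size S ^ 2)))
  * (size P * n ^ 2 * (K1 * (L * n ^ 4)))))).
  apply: leq_mul; first by rewrite leq_exp2r.
  by apply: leq_trans hX4 _; apply: leq_trans H4 _; rewrite !leq_mul.
have -> : n ^ 4 * (size P * size S ^ 2 * (K1 * (L * (size P * size S ^ 2)))
  * (size P * n ^ 2 * (K1 * (L * n ^ 4))))
  = size S ^ 4 * (K1 ^ 2 * (L ^ 2 * (size P ^ 3 * n ^ 10))) by ring.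
rewrite leq_mul2l; apply/orP; right.
apply: leq_mul; first by rewrite leq_pexp2l.
by apply: leq_mul; first by rewrite leq_pexp2l.
Qed.

(** The bound [M] concerns $q$-th powers, so [layer_cake] is run with the largest level value [b] in
    place of a $q$-th root of [M]. *)
Lemma layer_cake_power (T : eqType) (s : seq T) (r : T -> nat) (p q M : nat) :
  0 < p -> 0 < q -> {in s, forall i, r i < 2 ^ L} ->
  (forall t, 0 < t -> (t ^ p * \sum_(i <- s) (t <= r i)) ^ q <= M) ->
  (\sum_(i <- s) r i ^ p) ^ q <= (2 ^ p * L) ^ q * M.
Proof.
move=> p0 q0 hr hM.
pose b := \max_(t < 2 ^ L | 0 < t) (t ^ p * \sum_(i <- s) (t <= r i)).
have hb : b ^ q <= M.
  rewrite /b; elim/big_rec: _ => [|t x t0 hx]; first by rewrite exp0n.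
  by rewrite /maxn; case: ifP => // _; exact: hM.
apply: (@leq_trans ((2 ^ p * (L * b)) ^ q)); last first.
  by rewrite mulnA expnMn leq_mul2l hb orbT.
rewrite leq_exp2r //; apply: layer_cake => // t t0.
have [tL|Lt] := ltnP t (2 ^ L).
  exact: (@leq_bigmax_cond _ (fun t : 'I_(2 ^ L) => 0 < t)
    (fun t => t ^ p * \sum_(i <- s) (t <= r i)) (Ordinal tL) t0).
rewrite big_seq big1 ?muln0 // => i /hr ri.
by rewrite leqNgt (leq_trans ri Lt).
Qed.

Lemma ratio_difference_bound (D : seq F) : uniq D ->
  {in A & A, forall a b, (a - b)%R \in D} -> size D < 2 ^ L -> 0 < n ->
  n ^ 22 <= 2 ^ 12 * K1 ^ 5 * L ^ 9 * (size D ^ 10 * size P ^ 7).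
Proof.
move=> uD AD DL n0.
pose S := undup [seq (a + d)%R | a <- A, d <- D].
have AS : {in A & D, forall a d, (a + d)%R \in S}.
  by move=> a d aA dD; rewrite mem_undup; apply: allpairs_f.
have uS : uniq S by exact: undup_uniq.
have := energy_lower_bound uA uD uS AD AS.
have := @energy_upper_bound F K L A D S P [seq a^-1%R | a <- A] hK uA uD uS uP.
have : (\sum_(d <- D) diff_rep A d ^ 3) ^ 4
    <= (2 ^ 3 * L) ^ 4 * (K1 ^ 3 * (L ^ 3 * (size P ^ 3 * n ^ 10))).
  apply: layer_cake_power => // [d _|t t0].
    by apply: leq_ltn_trans AL; rewrite /diff_rep sum_mem_size size_filter count_size.
  rewrite sum_mem_size expnMn -expnM; apply: popular_diff_bound.
  - exact: filter_uniq.
  - by apply: leq_ltn_trans DL; rewrite size_filter count_size.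
  - by move=> d; rewrite mem_filter => /andP[].
move: (\sum_(d <- D) _) (\sum_(x <- S) _) => E3 E h3 h2 h1.
have {}h2 : E ^ 2 <= K1 * (L * (size P ^ 2 * size D ^ 3)).
  apply: h2 => //.
  - by rewrite map_inj_uniq //; exact: invr_inj.
  - move=> u a /mapP[b bA ->] aA; rewrite mulrC; exact: AP.
  - by apply/mapP => -[b bA /esym/eqP]; rewrite invr_eq0 => /eqP b0; move: A0; rewrite -b0 bA.
  - by rewrite size_map.
have n10 : 0 < n ^ 10 by rewrite expn_gt0 n0.
rewrite -(leq_pmul2l n10) -expnD.
(* Up to [K1] and [L], $E_3^4$ contributes $|P|^3n^{10}$ and $E^4$ contributes $|P|^4|D|^6$; then
   $n^{10}$ cancels. *)
apply: (@leq_trans ((size D * E3 * E) ^ 4)); first by rewrite (expnM _ 8 4) leq_exp2r.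
rewrite !expnMn (expnM E 2 2).
apply: leq_trans (leq_mul (leq_mul (leqnn _) h3) (_ : _ <= _ ^ 2)) _.
  by rewrite leq_exp2r; last by []; exact: h2.
by apply: eq_leq; ring.
Qed.

End RatioSet.

(** * Multiplicative energy and sums *)

Definition ratio_rep (F : fieldType) (A : seq F) (m : F) : nat :=
  \sum_(a <- A) ((m * a)%R \in A).

Section MultiplicativeEnergy.
Variables (F : fieldType) (A P : seq F).
Hypotheses (uA : uniq A) (uP : uniq P) (A0 : 0%R \notin A).
Hypothesis AP : {in A & A, forall a b, (a / b)%R \in P}.

Lemma regroup_ratio (g : F -> nat) :
  \sum_(b <- A) \sum_(a <- A) g (a / b)%R = \sum_(m <- P) ratio_rep A m * g m.
Proof.
rewrite (regroup2 g uP (h := fun b a => (a / b)%R)); last first.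
  by move=> b a bA aA; exact: AP.
apply: eq_bigr => m _; congr muln; apply: eq_sum_seq_in => b bA.
have b0 : b != 0%R by apply: contraNneq A0 => <-.
rewrite -(sum_eq_mem _ uA); apply: eq_bigr => a _; congr nat_of_bool.
by apply/eqP/eqP => [<-|->]; rewrite ?divfK ?mulfK.
Qed.

Lemma sum_ratio_rep : \sum_(m <- P) ratio_rep A m = size A ^ 2.
Proof.
transitivity (\sum_(m <- P) ratio_rep A m * 1).
  by under [RHS]eq_bigr do rewrite muln1.
by rewrite -(regroup_ratio (fun=> 1)) !sum_nat_const_seq muln1 mulnn.
Qed.

Lemma ratio_energy :
  size A ^ 4 <= size P * \sum_(m <- P) ratio_rep A m ^ 2.
Proof.
rewrite (expnM _ 2 2) -sum_ratio_rep -[X in X * _]muln1 -sum_nat_const_seq.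
by apply: cauchy_schwarz => m _; rewrite mul1n.
Qed.

(** Products and ratios share one energy, since $ab=a'b'$ means $a/b'=a'/b$; Cauchy-Schwarz over [Q]
    does the rest. *)
Lemma product_energy (Q : seq F) : uniq Q ->
  {in A & A, forall a b, (a * b)%R \in Q} ->
  size A ^ 4 <= size Q * \sum_(m <- P) ratio_rep A m ^ 2.
Proof.
move=> uQ AQ; pose c z := \sum_(b <- A) ((z / b)%R \in A).
have nz b : b \in A -> (b != 0)%R by move=> bA; apply: contraNneq A0 => <-.
have hc : size A ^ 2 <= \sum_(z <- Q) c z.
  rewrite exchange_big -mulnn -sum_nat_const_seq; apply: leq_sum_seq_in => b bA /=.
  rewrite -sum1_size.
  apply: (@count_inj_leq _ _ _ _ xpredT _ (fun a => (a * b)%R)) => //.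
    exact/mulIf/nz.
  by move=> a aA _; rewrite AQ // mulfK ?nz.
have h2 : \sum_(z <- Q) c z ^ 2 <= \sum_(m <- P) ratio_rep A m ^ 2.
  under [leqRHS]eq_bigr do rewrite -mulnn.
  rewrite -regroup_ratio; under eq_bigr do rewrite -mulnn big_distrlr.
  rewrite exchange_big /= ; apply: leq_sum_seq_in => b bA.
  rewrite exchange_big /= ; apply: leq_sum_seq_in => b' bA'.
  under eq_bigr do rewrite mulnb andbC.
  apply: (@count_inj_leq _ _ _ _ _ _ (fun z => (z / b')%R)) => //.
    by apply/mulIf; rewrite invr_eq0 nz.
  move=> z _ /andP[-> h] /=; move: h; congr (_ \in A).
  by field; rewrite !nz.
rewrite (expnM _ 2 2); apply: (@leq_trans ((\sum_(z <- Q) c z) ^ 2)).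
  by rewrite leq_exp2r.
apply: leq_trans (leq_mul (leqnn _) h2).
rewrite -[X in X * _]muln1 -sum_nat_const_seq.
by apply: cauchy_schwarz => m _; rewrite mul1n.
Qed.

End MultiplicativeEnergy.

(** * Multiplicative energy against the sum set *)

Section SumSet.
Variables (R : realType) (A S : seq R[i]).
Hypothesis uA : uniq A.
Hypothesis AS : {in A & A, forall a b, (a + b)%R \in S}.
Hypothesis A_acute : {in A & A, forall a b, (a + b != 0)%R /\ (nsq b <= nsq (a + b))%R}.

(* The sum of a point of slope [m] and one of slope [nn m] has its slope in
   the disc around [m] of radius [|nn m - m|]. *)
Lemma rich_slopes_bound (T : seq R[i]) (t : nat) : uniq T ->
  {in T, forall m, t <= ratio_rep A m} ->
  t ^ 2 * size T <= 16 * size S ^ 2.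
Proof.
move=> uT hT.
(* A single slope has no nearest neighbour; there $t\le|A|\le|S|$ suffices. *)
have [T1|T2] := leqP (size T) 1.
  case: T T1 uT hT => [|m [|//]] _ _ hT; first by rewrite muln0.
  rewrite muln1; have tn : t <= size A.
    apply: leq_trans (hT m (mem_head _ _)) _.
    by rewrite /ratio_rep sum_mem_size size_filter count_size.
  have [A0|A0] := posnP (size A); first by move: tn; rewrite A0 leqn0 => /eqP->.
  have [a aA] : exists a, a \in A by case: (A) A0 => // a ? _; exists a; rewrite mem_head.
  have nS : size A <= size S.
    apply: (@size_inj_leq _ _ _ _ (fun b => (a + b)%R)) => // [x y _ _ /addrI //|b bA].
    exact: AS.
  by apply: leq_trans (leq_pmull _ _) => //; rewrite leq_exp2r // (leq_trans tn).
have [nn hnn] := nearest_neighbour uT T2.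
pose near v w m := (nsq (w / v - m) <= nsq (nn m - m))%R.
apply: (@leq_trans (\sum_(m <- T) \sum_(p <- [seq (v, w) | v <- S, w <- S]) near p.1 p.2 m)).
  rewrite mulnC -sum_nat_const_seq; apply: leq_sum_seq_in => m mT.
  have [nT nm _] := hnn _ mT.
  apply: (@leq_trans (ratio_rep A m * ratio_rep A (nn m))).
    by rewrite -mulnn leq_mul ?hT.
  rewrite /ratio_rep big_distrlr /= -(big_allpairs (r1 := A) (r2 := A)
    (F := fun p => ((m * p.1)%R \in A) * ((nn m * p.2)%R \in A))).
  under eq_bigr do rewrite mulnb.
  apply: (@count_inj_leq _ _ _ _ _ _ (fun p => (p.1 + p.2, m * p.1 + nn m * p.2)%R)).
  - by apply: allpairs_uniq => // -[a b] [c d].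
  (* The linear map $(x,x')\mapsto(x+x',mx+m'x')$, with $m'$ standing for [nn m], is injective
     because $m'\ne m$. *)
  - move=> [x x'] [y y'] /= [e1 e2].
    have e : ((nn m - m) * (x' - y') = 0)%R.
      transitivity (m * x + nn m * x' - (m * y + nn m * y') - m * (x + x' - (y + y')))%R.
        ring.
      by rewrite e1 e2 !subrr mulr0 subrr.
    have e' : (x' = y')%R.
      apply/eqP; move/eqP: e; rewrite mulf_eq0 subr_eq0 (negbTE nm) /=.
      by rewrite subr_eq0.
    by rewrite e'; move: e1; rewrite e' => /addIr->.
  - move=> [x x']; rewrite mem_pairs /= => /andP[xA x'A] /andP[mx nx].
    rewrite mem_pairs !AS //= /near.
    have [s0 sle] := A_acute xA x'A.
    (* The deviation from [m] is at most $|m'-m|$ because [A_acute] gives $|x'|\le|x+x'|$. *)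
    have -> : ((m * x + nn m * x') / (x + x') - m = (nn m - m) * x' / (x + x'))%R.
      by field.
    have s0' : (0 < nsq (x + x'))%R by rewrite lt0r nsq_eq0 s0 nsq_ge0.
    rewrite -(ler_pM2r s0') -nsqM divfK // nsqM.
    by rewrite ler_wpM2l // nsq_ge0.
rewrite exchange_big big_allpairs mulnC -mulnn -mulnA -sum_nat_const_seq.
apply: leq_sum => v _; rewrite -sum_nat_const_seq; apply: leq_sum => w _ /=.
apply: (@kissing _ _ (fun m => nsq (nn m - m))%R) => // a b aT bT ab.
by have [_ _ h] := hnn _ aT; apply: h => //; rewrite eq_sym.
Qed.

Lemma multiplicative_energy_bound (P : seq R[i]) (L : nat) : uniq P ->
  size A < 2 ^ L ->
  \sum_(m <- P) ratio_rep A m ^ 2 <= 64 * (L * size S ^ 2).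
Proof.
move=> uP AL.
have -> : 64 * (L * size S ^ 2) = 2 ^ 2 * (L * (16 * size S ^ 2)) by ring.
apply: layer_cake => // [m _|t _].
  by apply: leq_ltn_trans AL; rewrite /ratio_rep sum_mem_size size_filter count_size.
rewrite sum_mem_size; apply: rich_slopes_bound; first exact: filter_uniq.
by move=> m; rewrite mem_filter => /andP[].
Qed.

End SumSet.

(** * Differences and products *)

(** A level maximising $t^p\,|\{i : r_i\ge t\}|$ dominates all others, so a single [t] carries the
    moment up to $2^pL$. *)
Lemma layer_witness (T : eqType) (s : seq T) (r : T -> nat) (p L : nat) :
  0 < p -> 0 < L -> {in s, forall i, r i < 2 ^ L} ->
  exists2 t, 0 < t &
    \sum_(i <- s) r i ^ p <= 2 ^ p * (L * (t ^ p * \sum_(i <- s) (t <= r i))).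
Proof.
move=> p0 L0 hr; pose f (t : 'I_(2 ^ L)) := t ^ p * \sum_(i <- s) (t <= r i).
have lt1 : 1 < 2 ^ L by rewrite -{1}(expn0 2) ltn_exp2l.
have [t t0 ht] := @arg_maxnP _ (Ordinal lt1) (fun t : 'I_(2 ^ L) => 0 < t) f isT.
exists t => //; apply: layer_cake => // u u0.
have [uL|Lu] := ltnP u (2 ^ L); first exact: (ht (Ordinal uL)).
rewrite big_seq big1 ?muln0 // => i /hr ri.
by rewrite leqNgt (leq_trans ri Lu).
Qed.

(** Summation of $\sqrt k\,q_i\le\sqrt c\,G_i$ without roots: the hypotheses for [i] and [j]
    multiply to $kq_iq_j\le cG_iG_j$. *)
Lemma leq_sum_sqr (T : eqType) (s : seq T) (q G : T -> nat) (k c : nat) :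
  {in s, forall i, k * q i ^ 2 <= c * G i ^ 2} ->
  k * (\sum_(i <- s) q i) ^ 2 <= c * (\sum_(i <- s) G i) ^ 2.
Proof.
move=> h; rewrite -!mulnn !big_distrlr /= !big_distrr /=.
apply: leq_sum_seq_in => i si; rewrite !big_distrr /=.
apply: leq_sum_seq_in => j sj; apply: sqr_leq.
have -> : (k * (q i * q j)) ^ 2 = (k * q i ^ 2) * (k * q j ^ 2) by ring.
have -> : (c * (G i * G j)) ^ 2 = (c * G i ^ 2) * (c * G j ^ 2) by ring.
by rewrite leq_mul ?h.
Qed.

(** * Lines with prescribed slopes through a finite point set *)

Section LinesThroughGrid.
Variables (F : fieldType) (T : seq F) (X : seq (F * F)).
Hypotheses (uT : uniq T) (uX : uniq X).

Definition line_dir (m : F) (p : F * F) : F * F := (m, p.2 - m * p.1)%R.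

Definition lines_through := undup [seq line_dir m p | m <- T, p <- X].

(** Cauchy-Schwarz on the number of points per line. A point meets itself once per slope, and two
    distinct points lie on at most one common line. *)
Lemma lines_through_bound :
  (size T * size X) ^ 2
    <= size lines_through * (size T * size X + size X ^ 2).
Proof.
pose c l := \sum_(m <- T) \sum_(p <- X) (line_dir m p == l).
have hl m p : m \in T -> p \in X -> line_dir m p \in lines_through.
  by move=> mT pX; rewrite mem_undup; apply: allpairs_f.
have uL : uniq lines_through by exact: undup_uniq.
have e1 (g : F * F -> nat) : \sum_(m <- T) \sum_(p <- X) g (line_dir m p)
    = \sum_(l <- lines_through) c l * g l.
  exact: regroup2.
have -> : size T * size X = \sum_(l <- lines_through) c l.
  transitivity (\sum_(l <- lines_through) c l * 1).
    by rewrite -(e1 (fun=> 1)) !sum_nat_const_seq muln1.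
  by apply: eq_bigr => l _; rewrite muln1.
apply: (@leq_trans (size lines_through * \sum_(l <- lines_through) c l ^ 2)).
  rewrite -[size _]muln1 -sum_nat_const_seq.
  by apply: cauchy_schwarz => l _; rewrite mul1n.
rewrite leq_mul2l; apply/orP; right.
under eq_bigr do rewrite -mulnn.
rewrite -e1 /c.
have -> : \sum_(l <- lines_through) c l = size X * size T.
  transitivity (\sum_(l <- lines_through) c l * 1).
    by apply: eq_bigr => l _; rewrite muln1.
  by rewrite -(e1 (fun=> 1)) !sum_nat_const_seq muln1 mulnC.
rewrite exchange_big /=.
rewrite -mulnn -mulnDr -sum_nat_const_seq; apply: leq_sum_seq_in => p pX.
apply: (@leq_trans (\sum_(m <- T) \sum_(p' <- X)
    (p'.2 - m * p'.1 == p.2 - m * p.1)%R)).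
  apply: leq_sum_seq_in => m mT.
  rewrite (bigD1_seq m) //= [X in _ + X]big1 ?addn0 => [|m' /negbTE mm'].
    by apply: leq_sum => p' _; rewrite /line_dir xpair_eqE eqxx.
  by rewrite big1 // => p' _; rewrite /line_dir xpair_eqE mm'.
rewrite exchange_big /= (bigD1_seq p) //= leq_add //.
  rewrite -[leqRHS]muln1 -sum_nat_const_seq.
  by apply: leq_sum => m _; rewrite leq_b1.
rewrite -[leqRHS]muln1 -sum_nat_const_seq [leqLHS]big_mkcond /=.
apply: leq_sum => p' _; case: ifP => // pp'.
have [e|ne] := eqVneq p'.1 p.1.
  rewrite big1 // => m _; rewrite e; apply/eqP; rewrite eqb0.
  apply: contra pp' => /eqP/addIr e2.
  by rewrite [p']surjective_pairing e e2 -surjective_pairing.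
apply: (@leq_trans (\sum_(m <- T) (m == (p'.2 - p.2) / (p'.1 - p.1))%R)).
  apply: leq_sum => m _; case: eqP => // h; rewrite lt0b.
  have d0 : (p'.1 - p.1 != 0)%R by rewrite subr_eq0.
  apply/eqP; apply: (mulIf d0); rewrite divfK //.
  have -> : (p'.2 = p.2 - m * p.1 + m * p'.1)%R by rewrite -h subrK.
  by ring.
by rewrite sum_eq_mem // leq_b1.
Qed.

End LinesThroughGrid.

Section ProductSet.
Variables (F : fieldType) (K L : nat) (A D P : seq F).
Hypotheses (hK : rich_lines_bound F K) (uA : uniq A) (uD : uniq D) (uP : uniq P).
Hypothesis P0 : 0%R \notin P.
Hypothesis AD : {in A & A, forall a b, (a - b)%R \in D}.
Hypotheses (L0 : 0 < L) (AL : size A < 2 ^ L) (DL : size D < 2 ^ L).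
Hypotheses (sP : size P <= size A ^ 2) (sA : 0 < size A).

Local Notation n := (size A).
Local Notation K1 := (8 * K).+1.

Let fib m := [seq a <- A | (m * a)%R \in A].

Let uf m : uniq (fib m). Proof. exact: filter_uniq. Qed.

Let size_fib m : size (fib m) = ratio_rep A m.
Proof. by rewrite /ratio_rep sum_mem_size. Qed.

Let fibAD m : {in fib m & fib m, forall a b, (a - b)%R \in D}.
Proof.
by move=> a b; rewrite !mem_filter => /andP[_ aA] /andP[_ bA]; exact: AD.
Qed.

Let nD : n <= size D.
Proof.
have [b bA] : exists b, b \in A by case: (A) sA => // b ? _; exists b; rewrite mem_head.
apply: (@size_inj_leq _ _ _ _ (fun a => (a - b)%R)) => // [x y _ _ /addIr //|a aA].
exact: AD.
Qed.

(** This is $|B\cap(B-s)\cap(B-s')|$. *)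
Definition triple (B : seq F) (s s' : F) : nat :=
  \sum_(b <- B) (((b + s)%R \in B) && ((b + s')%R \in B)).

(** A triple of elements of [fib m] is encoded by its first element and two differences. *)
Lemma sum_triple_fib m :
  ratio_rep A m ^ 3 <= \sum_(s <- D) \sum_(s' <- D) triple (fib m) s s'.
Proof.
under eq_bigr do rewrite exchange_big /=.
rewrite exchange_big /= -size_fib expnS -sum_nat_const_seq.
apply: leq_sum_seq_in => a am.
apply: (@leq_trans ((\sum_(s <- D) ((a + s)%R \in fib m)) ^ 2)); last first.
  rewrite -mulnn big_distrlr /=; apply: leq_sum => s _.
  by apply: leq_sum => s' _; rewrite mulnb.
rewrite leq_exp2r // -sum1_size.
apply: (@count_inj_leq _ _ _ _ xpredT _ (fun b => (b - a)%R)) => //.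
  by move=> x y /addIr.
by move=> b bm _; rewrite (fibAD bm am) addrC subrK.
Qed.

(** For base points [a], [b] with common shifts, each of [s] and [s'] has at most
    [diff_rep (fib m) (a - b)] choices. *)
Lemma sum_triple_fib_sqr m :
  \sum_(s <- D) \sum_(s' <- D) triple (fib m) s s' ^ 2
    <= \sum_(d <- D) diff_rep (fib m) d ^ 3.
Proof.
under [leqRHS]eq_bigr do rewrite expnS.
rewrite -(regroup_diff (uf m) uD (@fibAD m)).
under eq_bigr do under eq_bigr do rewrite -mulnn big_distrlr /=.
under eq_bigr do rewrite exchange_big /=.
rewrite exchange_big /=; apply: leq_sum_seq_in => a am.
under eq_bigr do rewrite exchange_big /=.
rewrite exchange_big /=; apply: leq_sum_seq_in => b bm.
apply: (@leq_trans ((\sum_(s <- D) (((a + s)%R \in fib m) && ((b + s)%R \in fib m))) ^ 2)).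
  rewrite -mulnn big_distrlr /=; apply: leq_sum => s _; apply: leq_sum => s' _.
  by rewrite -!mulnb mulnACA.
rewrite leq_exp2r //.
apply: (@count_inj_leq _ _ _ _ _ _ (fun s => (a + s)%R)) => //.
  exact: addrI.
by move=> s _ /andP[-> h]; rewrite opprB addrC addrA subrK.
Qed.

Variables (t : nat).
Let T := [seq m <- P | t <= ratio_rep A m].

Let uT : uniq T. Proof. exact: filter_uniq. Qed.
Let T0 : 0%R \notin T. Proof. by rewrite mem_filter negb_and P0 orbT. Qed.
Let sT : size T <= n ^ 2.
Proof. by apply: leq_trans sP; rewrite size_filter count_size. Qed.

Lemma triple_fib_first :
  size T * t ^ 3 <= \sum_(m <- T) \sum_(s <- D) \sum_(s' <- D) triple (fib m) s s'.
Proof.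
rewrite -sum_nat_const_seq; apply: leq_sum_seq_in => m.
rewrite mem_filter => /andP[tm _]; apply: leq_trans (sum_triple_fib m).
by rewrite leq_exp2r.
Qed.

(** If [a] and $a-d$ lie in [fib m], then $(ma,a-d)$ is a point of $A\times A$ on the line of slope
    $m^{-1}$ and intercept $-d$; so [third_moment] applies. *)
Lemma triple_fib_second :
  \sum_(m <- T) \sum_(s <- D) \sum_(s' <- D) triple (fib m) s s' ^ 2
    <= K1 * (L * n ^ 4).
Proof.
apply: (@leq_trans (\sum_(m <- T) \sum_(d <- D) diff_rep (fib m) d ^ 3)).
  by apply: leq_sum => m _; exact: sum_triple_fib_sqr.
pose r (i : F * F) := diff_rep (fib i.1) i.2.
rewrite -(big_allpairs (r1 := T) (r2 := D) (F := fun i => r i ^ 3)).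
apply: leq_trans (third_moment (f := fun i => (i.1^-1, - i.2)%R) hK uA uA _ L0 _ _) _.
- by apply: allpairs_uniq => // -[a b] [c d].
- by move=> [m d] [m' d'] _ _ /= [/invr_inj-> /oppr_inj->].
- move=> [m d]; rewrite mem_pairs /r /= => /andP[mT _].
  have m0 : m != 0%R by apply: contraNneq T0 => <-.
  split; first by rewrite invr_eq0.
    apply: (@count_inj_leq _ _ _ _ _ _ (fun a => (m * a)%R)); first exact: uf.
      exact: mulfI.
    by move=> a; rewrite !mem_filter /= => /andP[-> _] /andP[_ h]; rewrite mulKf.
  apply: leq_ltn_trans AL; rewrite /diff_rep sum_mem_size size_filter.
  by apply: leq_trans (count_size _ _) _; rewrite size_filter count_size.
- have h : \sum_(i <- [seq (a, b) | a <- T, b <- D]) r i <= L * n ^ 4.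
    apply: leq_trans (leq_pmull _ L0); rewrite big_allpairs /r /=.
    have -> : n ^ 4 = n ^ 2 * n ^ 2 by ring.
    apply: leq_trans (leq_mul sT (leqnn _)); rewrite -sum_nat_const_seq.
    apply: leq_sum => m _; rewrite (sum_diff_rep (uf m) uD (@fibAD m)) leq_exp2r //.
    by rewrite size_filter count_size.
  have -> : K1 * (L * n ^ 4) = L * n ^ 4 + 8 * (L * (K * (n ^ 2 * n ^ 2))) by ring.
  by rewrite leq_add2r.
Qed.

(** A summand counts collinear points $(d,e)$, $(d+s,e+ms)$, $(d+s',e+ms')$ of $D\times D$, so the
    sum is at most a third moment of incidences. *)
Lemma triple_diff_lines :
  \sum_(m <- T) \sum_(s <- D) \sum_(s' <- D) triple D s s' * triple D (m * s) (m * s')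
    <= K1 * (L * size D ^ 4).
Proof.
pose B := undup [seq (e - p.1 * p.2)%R | p <- [seq (m, d) | m <- T, d <- D], e <- D].
have uB : uniq B by exact: undup_uniq.
apply: (@leq_trans (\sum_(m <- T) \sum_(b <- B) incid D D (m, b) ^ 3)).
  apply: leq_sum_seq_in => m mT.
  apply: (@leq_trans (\sum_(d <- D) \sum_(e <- D) incid D D (m, e - m * d)%R ^ 2)).
    under eq_bigr do under eq_bigr do rewrite big_distrlr /=.
    under eq_bigr do rewrite exchange_big /=.
    rewrite exchange_big /=; apply: leq_sum => d _.
    under eq_bigr do rewrite exchange_big /=.
    rewrite exchange_big /=; apply: leq_sum => e _.
    apply: (@leq_trans ((\sum_(s <- D) (((d + s)%R \in D) && ((e + m * s)%R \in D))) ^ 2)).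
      rewrite -mulnn big_distrlr /=; apply: leq_sum => s _; apply: leq_sum => s' _.
      by rewrite -!mulnb mulnACA.
    rewrite leq_exp2r //.
    apply: (@count_inj_leq _ _ _ _ _ _ (fun s => (d + s)%R)) => //.
      exact: addrI.
    move=> s _ /andP[-> h] /=; move: h; congr (_ \in D); ring.
  have -> : \sum_(d <- D) \sum_(e <- D) incid D D (m, e - m * d)%R ^ 2
    = \sum_(b <- B) (\sum_(d <- D) \sum_(e <- D) ((e - m * d)%R == b))
        * incid D D (m, b) ^ 2.
    apply: (@regroup2 _ _ _ D D B (fun d e => e - m * d)%R
      (fun b => incid D D (m, b) ^ 2)) => // d e dD eD.
    rewrite mem_undup; apply/allpairsP; exists ((m, d), e) => /=.
    by rewrite mem_pairs mT dD.
  apply: leq_sum => b _; rewrite [leqRHS]expnS leq_mul2r; apply/orP; right.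
  apply: leq_sum => d _ /=; rewrite -(sum_eq_mem _ uD).
  by apply: leq_sum => e _; rewrite subr_eq addrC.
rewrite -(big_allpairs (r1 := T) (r2 := B) (F := fun l => incid D D l ^ 3)).
apply: leq_trans (incid_third_moment hK uD uD uT uB L0 DL T0) _.
have -> : K1 * (L * size D ^ 4)
  = L * size D ^ 4 + 8 * (L * (K * (size D ^ 2 * size D ^ 2))) by ring.
rewrite leq_add2r; apply: leq_trans (leq_pmull _ L0).
have -> : size D ^ 4 = size D ^ 2 * (size D * size D) by ring.
by rewrite leq_mul2r; apply/orP; right; apply: leq_trans sT _; rewrite leq_exp2r.
Qed.

(** By [lines_through_bound] the $q^2$ grid points span at least $|T|^2q^2/(|T|+q^2)$ lines with
    slopes in [T]. The line of slope $m'$ through a grid point $(x,y)$ is rich: it contains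
    $(x-b,y-m'b)$ for all [b] in [fib m']. *)
Lemma triple_diff_lower (m s s' : F) : 1 < t -> m \in T ->
  t ^ 3 * (size T ^ 2 * triple (fib m) s s' ^ 2)
    <= K * (triple D s s' * triple D (m * s) (m * s')) ^ 2
       * (size T + triple (fib m) s s' ^ 2).
Proof.
move=> t1 mT; set q := triple (fib m) s s'.
pose tr (B : seq F) (u u' : F) := [seq b <- B | ((b + u)%R \in B) && ((b + u')%R \in B)].
have str B u u' : size (tr B u u') = triple B u u' by rewrite /triple sum_mem_size.
have m0 : m != 0%R by apply: contraNneq T0 => <-.
have [->|q0] := posnP q; first by rewrite exp0n // !muln0.
pose X := [seq (x, y) | x <- tr (fib m) s s', y <- map (fun x => (m * x)%R) (tr (fib m) s s')].
have sX : size X = q ^ 2 by rewrite size_allpairs size_map str mulnn.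
have uX : uniq X.
  apply: allpairs_uniq; first exact/filter_uniq/uf.
    by rewrite map_inj_uniq; [exact/filter_uniq/uf|exact: mulfI].
  by move=> [a b] [c d].
have := lines_through_bound uT uX; rewrite sX.
set Ls := lines_through T X => hL.
have hrich : t ^ 3 * size Ls
    <= K * (size (tr D s s') ^ 2 * size (tr D (m * s)%R (m * s')%R) ^ 2).
  apply: (@rich_index F K _ _ _ Ls id t) => //; try exact: filter_uniq.
    exact: undup_uniq.
  move=> l; rewrite mem_undup => /allpairsP[[m' [x y]] /= [m'T xyX ->]].
  rewrite /line_dir /=; split; first by apply: contraNneq T0 => <-.
  move: m'T; rewrite mem_filter => /andP[tm' _]; apply: leq_trans tm' _.
  move: xyX; rewrite mem_pairs !mem_filter -/(fib m) => /andP[].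
  move=> /andP[/andP[/andP[_ xs] /andP[_ xs']] /andP[_ xA]].
  move=> /mapP[z]; rewrite !mem_filter.
  move=> /andP[/andP[/andP[zs _] /andP[zs' _]] /andP[zA _]] ey.
  apply: (@count_inj_leq _ _ _ _ _ _ (fun b => (x - b)%R)) => //.
    by move=> b c /addrI/oppr_inj.
  move=> b bA m'b; rewrite !mem_filter /= AD // andbT.
  have -> : (m' * (x - b) + (y - m' * x) = y - m' * b)%R by ring.
  rewrite ey AD // andbT.
  have -> : (m * z - m' * b + m * s = m * (z + s) - m' * b)%R by ring.
  have -> : (m * z - m' * b + m * s' = m * (z + s') - m' * b)%R by ring.
  by rewrite [(x - b + _)%R]addrAC [(x - b + _)%R]addrAC !AD.
rewrite !str in hrich.
have q2 : 0 < q ^ 2 by rewrite expn_gt0 q0.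
rewrite -(leq_pmul2l q2).
have -> : q ^ 2 * (t ^ 3 * (size T ^ 2 * q ^ 2)) = t ^ 3 * (size T * q ^ 2) ^ 2 by ring.
apply: (@leq_trans (t ^ 3 * size Ls * (size T * q ^ 2 + (q ^ 2) ^ 2))).
  by rewrite -mulnA leq_mul2l hL orbT.
apply: leq_trans (leq_mul hrich (leqnn _)) _.
by apply: eq_leq; ring.
Qed.

(** At least half of $\sum q\ge|T|t^3$ comes either from $q^2\le|T|$, where [triple_diff_lower]
    reads $t^3|T|q^2\le2KG^2$, or from the rest, where $|T|q^2\le q^4$ and the second moment of $q$
    suffices. *)
Lemma popular_slopes_dichotomy : 1 < t -> 0 < size T ->
  (size T ^ 3 * t ^ 9 <= 8 * K * (K1 ^ 2 * (L ^ 2 * size D ^ 8)))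
  \/ (size T ^ 3 * t ^ 6 <= 4 * (K1 ^ 2 * (L ^ 2 * n ^ 8))).
Proof.
move=> t1 N0.
pose I := [seq (m, p) | m <- T, p <- [seq (s, s') | s <- D, s' <- D]].
pose q (i : F * (F * F)) := triple (fib i.1) i.2.1 i.2.2.
pose G (i : F * (F * F)) :=
  triple D i.2.1 i.2.2 * triple D (i.1 * i.2.1) (i.1 * i.2.2).
have sumI (f : F * (F * F) -> nat) : \sum_(i <- I) f i =
    \sum_(m <- T) \sum_(s <- D) \sum_(s' <- D) f (m, (s, s')).
  by rewrite big_allpairs; apply: eq_bigr => m _; rewrite big_allpairs.
have h1 : size T * t ^ 3 <= \sum_(i <- I) q i by rewrite sumI triple_fib_first.
have h2 : \sum_(i <- I) q i ^ 2 <= K1 * (L * n ^ 4) by rewrite sumI triple_fib_second.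
have h3 : \sum_(i <- I) G i <= K1 * (L * size D ^ 4) by rewrite sumI triple_diff_lines.
pose q1 i := if q i ^ 2 <= size T then q i else 0.
pose q2 i := if q i ^ 2 <= size T then 0 else q i.
have h12 : \sum_(i <- I) q i = \sum_(i <- I) q1 i + \sum_(i <- I) q2 i.
  rewrite -big_split; apply: eq_bigr => i _; rewrite /q1 /q2 /=.
  by case: ifP; rewrite ?addn0.
have Q1 : t ^ 3 * size T * (\sum_(i <- I) q1 i) ^ 2 <= 2 * K * (\sum_(i <- I) G i) ^ 2.
  apply: leq_sum_sqr => -[m [s s']]; rewrite mem_pairs => /andP[mT _].
  rewrite /q1; case: ifP => [qT|_]; last by rewrite exp0n ?muln0.
  rewrite -(leq_pmul2l N0).
  have := triple_diff_lower s s' t1 mT; rewrite -/(q (m, (s, s'))).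
  rewrite -[triple D _ _ * _]/(G (m, (s, s'))).
  move: (q _) (G _) qT => x g xT hx.
  have -> : size T * (t ^ 3 * size T * x ^ 2) = t ^ 3 * (size T ^ 2 * x ^ 2) by ring.
  apply: leq_trans hx _.
  have -> : size T * (2 * K * g ^ 2) = K * g ^ 2 * (size T + size T) by ring.
  by rewrite leq_mul2l leq_add2l xT orbT.
have Q2 : size T * (\sum_(i <- I) q2 i) ^ 2 <= 1 * (\sum_(i <- I) q i ^ 2) ^ 2.
  apply: leq_sum_sqr => i _; rewrite /q2 mul1n.
  case: (leqP (q i ^ 2) (size T)) => qT; first by rewrite exp0n ?muln0.
  by rewrite -[X in _ <= X]mulnn leq_mul2r (ltnW qT) orbT.
move: (\sum_(i <- I) q1 i) (\sum_(i <- I) q2 i) h12 Q1 Q2 => x1 x2 h12 Q1 Q2.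
have [h|h] : size T * t ^ 3 <= 2 * x1 \/ size T * t ^ 3 <= 2 * x2.
- move: h1; rewrite h12; case: (leqP x1 x2) => h; [right|left]; lia.
- left; have -> : size T ^ 3 * t ^ 9 = t ^ 3 * size T * (size T * t ^ 3) ^ 2 by ring.
  apply: (@leq_trans (t ^ 3 * size T * (2 * x1) ^ 2)).
    by rewrite leq_mul2l leq_exp2r // h orbT.
  have -> : t ^ 3 * size T * (2 * x1) ^ 2 = 4 * (t ^ 3 * size T * x1 ^ 2) by ring.
  apply: (@leq_trans (4 * (2 * K * (K1 * (L * size D ^ 4)) ^ 2))).
    by rewrite leq_mul2l /=; apply: leq_trans Q1 _; rewrite leq_mul2l leq_exp2r // h3 orbT.
  by apply: eq_leq; ring.
- right; have -> : size T ^ 3 * t ^ 6 = size T * (size T * t ^ 3) ^ 2 by ring.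
  apply: (@leq_trans (size T * (2 * x2) ^ 2)).
    by rewrite leq_mul2l leq_exp2r // h orbT.
  have -> : size T * (2 * x2) ^ 2 = 4 * (size T * x2 ^ 2) by ring.
  apply: (@leq_trans (4 * (K1 * (L * n ^ 4)) ^ 2)).
    by rewrite leq_mul2l /=; apply: leq_trans Q2 _; rewrite mul1n leq_exp2r.
  by apply: eq_leq; ring.
Qed.

End ProductSet.

(** One level [t] carries the energy, and $t|T|\le n^2$ then gives $n^2\le4L|Q|t$. The outcomes are
    $t=1$ and the two sides of the dichotomy. *)
Lemma product_difference_bound (F : fieldType) (K L : nat) (A D P Q : seq F) :
  rich_lines_bound F K -> uniq A -> uniq D -> uniq P -> uniq Q ->
  0%R \notin A -> 0%R \notin P ->
  {in A & A, forall a b, (a / b)%R \in P} ->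
  {in A & A, forall a b, (a - b)%R \in D} ->
  {in A & A, forall a b, (a * b)%R \in Q} ->
  0 < L -> size A < 2 ^ L -> size D < 2 ^ L -> size P <= size A ^ 2 ->
  0 < size A ->
  [\/ size A ^ 2 <= 4 * L * size Q,
      size A ^ 4 <= 4 ^ 4 * (8 * K).+1 ^ 2 * L ^ 5 * size Q ^ 3
    | size A ^ 18 <= 4 ^ 6 * (8 * K) * (8 * K).+1 ^ 2 * L ^ 8
                     * (size Q ^ 6 * size D ^ 8)].
Proof.
move=> hK uA uD uP uQ A0 P0 AP AD AQ L0 AL DL sP sA.
have hE := product_energy uA uP A0 AP uQ AQ.
have [|t t0] := @layer_witness _ P (ratio_rep A) 2 L isT L0.
  by move=> m _; apply: leq_ltn_trans AL; rewrite /ratio_rep sum_mem_size size_filter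
    count_size.
rewrite sum_mem_size => /(leq_mul (leqnn (size Q)))/(leq_trans hE).
have := popular_slopes_dichotomy hK uA uD uP P0 AD L0 AL DL sP sA.
move=> /(_ t).
set T := filter _ _ => dich ht.
have tT : t * size T <= size A ^ 2.
  rewrite -(sum_ratio_rep uA uP A0 AP) -sum_mem_size big_distrr /=.
  by apply: leq_sum => m _; case: (boolP (t <= ratio_rep A m)) => h; rewrite ?muln1 ?muln0.
have n2 : 0 < size A ^ 2 by rewrite expn_gt0 sA.
have ht' : size A ^ 2 <= 4 * L * size Q * t.
  rewrite -(leq_pmul2l n2) -expnD; apply: leq_trans ht _.
  have -> : size Q * (2 ^ 2 * (L * (t ^ 2 * size T)))
    = (t * size T) * (4 * L * size Q * t) by ring.
  by rewrite leq_mul2r tT orbT.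
have T0 : 0 < size T.
  case: (posnP (size T)) ht => // ->; rewrite !muln0 leqn0 => /eqP h.
  by have : 0 < size A ^ 4 by [rewrite expn_gt0 sA]; rewrite h.
have [t1|t1] := leqP t 1.
  have e : t = 1 by lia.
  by apply: Or31; move: ht'; rewrite e muln1.
have h12 : size A ^ 12 <= (4 * L * size Q) ^ 3 * (size T ^ 3 * t ^ 6).
  rewrite (expnM _ 4 3) -(leq_exp2r _ _ (isT : 0 < 3)) in ht *.
  by apply: leq_trans ht _; apply: eq_leq; ring.
have n8 : 0 < size A ^ 8 by rewrite expn_gt0 sA.
case: (dich t1 T0) => h; [apply: Or33|apply: Or32].
(* Three factors $n^2\le4L|Q|t$ raise $t^6$ to the $t^9$ of the dichotomy. *)
- have -> : size A ^ 18 = size A ^ 12 * (size A ^ 2) ^ 3 by ring.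
  apply: (@leq_trans ((4 * L * size Q) ^ 3 * (size T ^ 3 * t ^ 6)
                      * (4 * L * size Q * t) ^ 3)).
    by rewrite leq_mul // leq_exp2r.
  have -> : (4 * L * size Q) ^ 3 * (size T ^ 3 * t ^ 6) * (4 * L * size Q * t) ^ 3
    = (4 * L * size Q) ^ 6 * (size T ^ 3 * t ^ 9) by ring.
  apply: leq_trans (leq_mul (leqnn _) h) _.
  by apply: eq_leq; ring.
- rewrite -(leq_pmul2l n8) -expnD; apply: leq_trans h12 _.
  apply: leq_trans (leq_mul (leqnn _) h) _.
  by apply: eq_leq; ring.
Qed.

(** * The four inequalities *)

(** Nonzero elements with nonnegative pairwise inner products satisfy this; the slope argument needs
    only this consequence. *)
Definition acute (R : realType) (A : seq R[i]) :=
  {in A & A, forall a b, (a + b != 0)%R /\ (nsq b <= nsq (a + b))%R}.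

Lemma quadrant_acute (R : realType) (A : seq R[i]) (q : bool * bool) :
  0%R \notin A ->
  {in A, forall z, (0 <= complex.Re z, 0 <= complex.Im z)%R = q} -> acute A.
Proof.
case: q => q1 q2 A0 hA a b aA bA.
have [e1 e2] := hA a aA; have [e3 e4] := hA b bA.
have sg (x y : R) : (0 <= x)%R = (0 <= y)%R -> (0 <= x * y)%R.
  case: (leP 0%R x) => [a0 /esym b0|a0 /esym]; first by rewrite mulr_ge0.
  by move/negbT; rewrite -ltNge => b0; rewrite nmulr_rge0 // ltW.
have hre := sg _ _ (etrans e1 (esym e3)); have him := sg _ _ (etrans e2 (esym e4)).
have e : (nsq (a + b) = nsq a + nsq b
    + 2 * (complex.Re a * complex.Re b + complex.Im a * complex.Im b))%R.
  by move: a b {aA bA e1 e2 e3 e4 hre him} => [x y] [z w]; rewrite /nsq /=; ring.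
have a0 : (0 < nsq a)%R.
  by rewrite lt0r nsq_ge0 nsq_eq0 andbT; apply: contraNneq A0 => <-.
have b0 := nsq_ge0 b.
split; last by rewrite e; lra.
by rewrite -nsq_eq0 gt_eqF // e; lra.
Qed.

(** Pigeonhole over four quadrants; removing 0 costs at most half of a set with two or more
    elements, whence 8. *)
Lemma acute_subset (R : realType) (A : seq R[i]) : uniq A -> 1 < size A ->
  exists B : seq R[i], [/\ uniq B, {subset B <= A}, 0%R \notin B, acute B
    & size A <= 8 * size B].
Proof.
move=> uA A2.
pose B (q : bool * bool) := [seq z <- A | (z != 0)%R &&
  ((0 <= complex.Re z, 0 <= complex.Im z)%R == q)].
have hB q : [/\ uniq (B q), {subset B q <= A}, 0%R \notin B q & acute (B q)].
  have B0 : 0%R \notin B q by rewrite mem_filter eqxx.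
  split=> //; first exact: filter_uniq.
    by move=> z; rewrite mem_filter => /andP[].
  apply: (quadrant_acute B0 (q := q)) => z; rewrite mem_filter.
  by move=> /andP[/andP[_ /eqP]].
have hs : size A <= 1 + (size (B (true, true)) + size (B (true, false))
    + size (B (false, true)) + size (B (false, false))).
  rewrite /B -!sum_mem_size -!big_split /= -(count_predC (pred1 0%R)).
  rewrite count_uniq_mem // leq_add ?leq_b1 // -size_filter -sum_mem_size.
  apply: leq_sum => z _ /=; case: (z == 0)%R => //=.
  by case: (0 <= _)%R; case: (0 <= _)%R.
have [q hq] : exists q, size A <= 8 * size (B q).
  apply: boolp.contrapT => hn.
  have H q : 8 * size (B q) < size A.
    by rewrite ltnNge; apply/negP => h; apply: hn; exists q.
  have := H (true, true); have := H (true, false); have := H (false, true).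
  have := H (false, false); lia.
by have [? ? ? ?] := hB q; exists (B q).
Qed.

(** Returns from the subset to the full set, and lets one constant and one power of [L] serve every
    case. *)
Lemma absorb (N n p q L e C M c Cc : nat) :
  0 < p -> 0 < q -> 0 < L -> e <= 9 * q -> N <= 8 * n ->
  c = 8 ^ p * C -> c <= Cc -> n ^ p <= C * L ^ e * M ^ q ->
  N ^ p <= (Cc * L ^ 9 * M) ^ q.
Proof.
move=> p0 q0 L0 eq Nn -> hC hn.
apply: (@leq_trans ((8 * n) ^ p)); first by rewrite leq_exp2r.
rewrite expnMn; apply: leq_trans (leq_mul (leqnn _) hn) _.
rewrite (expnMn (_ * _) M) (expnMn Cc) -(expnM L) [8 ^ p * _]mulnA.
rewrite [8 ^ p * (_ * _)]mulnA leq_mul2r; apply/orP; right.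
apply: leq_mul; last by rewrite leq_pexp2l.
apply: leq_trans hC _; case: Cc => // Cc.
by rewrite -{1}[Cc.+1]expn1 leq_pexp2l.
Qed.

Lemma subset_size (T : choiceType) (s : seq T) (B : {fset T}) :
  uniq s -> {subset s <= B} -> size s <= #|` B|.
Proof. by move=> us sB; apply: uniq_leq_size. Qed.

Lemma sum_product_nat (R : realType) : exists Cc : nat, 0 < Cc /\
  forall A : {fset R[i]}, 2 <= #|` A| ->
  let N := #|` A| in let L := 2 * (trunc_log 2 N).+1 in
  [/\ N ^ 22 <= (Cc * L ^ 9 * (#|` diffset A| + #|` ratioset A|)) ^ 17,
      N ^ 4 <= (Cc * L ^ 9 * (#|` sumset A| + #|` ratioset A|)) ^ 3,
      [\/ N ^ 2 <= (Cc * L ^ 9 * (#|` diffset A| + #|` prodset A|)) ^ 1,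
          N ^ 4 <= (Cc * L ^ 9 * (#|` diffset A| + #|` prodset A|)) ^ 3
        | N ^ 18 <= (Cc * L ^ 9 * (#|` diffset A| + #|` prodset A|)) ^ 14]
    & N ^ 4 <= (Cc * L ^ 9 * (#|` sumset A| + #|` prodset A|)) ^ 3].
Proof.
have := @complex_rich_lines R; move: (3 * 48 ^ 2) => K hK.
have name (x : nat) : exists c, c = x by exists x.
have [c1 e1] := name (8 ^ 22 * (2 ^ 12 * (8 * K).+1 ^ 5)).
have [c2 e2] := name (8 ^ 4 * 64).
have [c3 e3] := name (8 ^ 2 * 4).
have [c4 e4] := name (8 ^ 4 * (4 ^ 4 * (8 * K).+1 ^ 2)).
have [c5 e5] := name (8 ^ 18 * (4 ^ 6 * (8 * K) * (8 * K).+1 ^ 2)).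
pose Cc := (c1 + c2 + c3 + c4 + c5).+1.
exists Cc; split=> // A N2 N L.
have [B [uB BA B0 aB hN]] := acute_subset (fset_uniq A) N2.
rewrite -/N in hN.
have nN : size B <= N by exact: subset_size.
have n0 : 0 < size B by move: hN; rewrite /N; lia.
pose D := undup [seq (a - b)%R | a <- B, b <- B].
pose S := undup [seq (a + b)%R | a <- B, b <- B].
pose P := undup [seq (a / b)%R | a <- B, b <- B].
pose Q := undup [seq (a * b)%R | a <- B, b <- B].
have hin (op : R[i] -> R[i] -> R[i]) :
    {in B & B, forall a b, op a b \in undup [seq op a b | a <- B, b <- B]}.
  by move=> a b aB' bB; rewrite mem_undup; exact: allpairs_f.
have hsz (op : R[i] -> R[i] -> R[i]) :
    size (undup [seq op a b | a <- B, b <- B]) <= size B ^ 2.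
  by apply: leq_trans (size_undup _) _; rewrite size_allpairs mulnn.
have nz b : b \in B -> (b != 0)%R by move=> bB; apply: contraNneq B0 => <-.
have sD : size D <= #|` diffset A|.
  apply: subset_size; first exact: undup_uniq.
  move=> x; rewrite mem_undup => /allpairsP[[a b] /= [aB' bB ->]].
  by apply/imfset2P; exists a; [exact: BA|exists b => //; exact: BA].
have sS : size S <= #|` sumset A|.
  apply: subset_size; first exact: undup_uniq.
  move=> x; rewrite mem_undup => /allpairsP[[a b] /= [aB' bB ->]].
  by apply/imfset2P; exists a; [exact: BA|exists b => //; exact: BA].
have sQ : size Q <= #|` prodset A|.
  apply: subset_size; first exact: undup_uniq.
  move=> x; rewrite mem_undup => /allpairsP[[a b] /= [aB' bB ->]].
  by apply/imfset2P; exists a; [exact: BA|exists b => //; exact: BA].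
have sP : size P <= #|` ratioset A|.
  apply: subset_size; first exact: undup_uniq.
  move=> x; rewrite mem_undup => /allpairsP[[a b] /= [aB' bB ->]].
  apply/imfset2P; exists a; first exact: BA.
  by exists b => //; rewrite inE /= nz // andbT; exact: BA.
have L0 : 0 < L by [].
have [C1 C2 C3 C4 C5] : [/\ c1 <= Cc, c2 <= Cc, c3 <= Cc, c4 <= Cc & c5 <= Cc].
  by rewrite /Cc; clear; split; lia.
(* The factor 2 in [L] is there for the difference set, which may have about $n^2$ elements. *)
have NL : N ^ 2 < 2 ^ L.
  rewrite /L [2 * _]mulnC expnM ltn_exp2r //.
  by have /andP[] := trunc_log_bounds (isT : 1 < 2) (ltnW N2 : 0 < N).
have nL : size B ^ 2 < 2 ^ L by apply: leq_ltn_trans NL; rewrite leq_exp2r.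
have BL : size B < 2 ^ L by apply: leq_ltn_trans nL; rewrite expnS expn1 leq_pmulr.
have DL : size D < 2 ^ L by apply: leq_ltn_trans nL; exact: hsz.
have P0 : 0%R \notin P.
  rewrite mem_undup; apply/negP => /allpairsP[[a b] /= [aB' bB /esym/eqP]].
  by rewrite mulf_eq0 invr_eq0 (negbTE (nz _ aB')) (negbTE (nz _ bB)).
have [uD uP uQ] : [/\ uniq D, uniq P & uniq Q] by rewrite !undup_uniq.
have hE : \sum_(m <- P) ratio_rep B m ^ 2 <= 64 * (L * size S ^ 2).
  by apply: multiplicative_energy_bound => //; exact: (hin +%R).
have BD : {in B & B, forall a b, (a - b)%R \in D} by exact: (hin (fun a b => a - b)%R).
have BP : {in B & B, forall a b, (a / b)%R \in P} by exact: (hin (fun a b => a / b)%R).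
have BQ : {in B & B, forall a b, (a * b)%R \in Q} by exact: (hin *%R).
have sP2 : size P <= size B ^ 2 by exact: hsz.
clearbody Cc; clear name; split.
- apply: (@absorb N (size B) 22 17 L 9 _ _ _ _ isT isT L0 isT hN e1 C1).
  apply: leq_trans (ratio_difference_bound hK uB uP B0 P0 BP L0 BL sP2 uD BD DL n0) _.
  apply: leq_mul; first exact: leqnn.
  rewrite (expnD _ 10 7).
  by apply: leq_mul; rewrite leq_exp2r ?(leq_trans sD) ?(leq_trans sP) ?leq_addr ?leq_addl.
- apply: (@absorb N (size B) 4 3 L 1 _ _ _ _ isT isT L0 isT hN e2 C2).
  apply: leq_trans (ratio_energy uB uP B0 BP) _.
  apply: leq_trans (leq_mul (leqnn _) hE) _.
  rewrite (_ : size P * (64 * (L * size S ^ 2)) = 64 * L ^ 1 * (size S ^ 2 * size P));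
    last by ring.
  apply: leq_mul; first exact: leqnn.
  rewrite (expnD _ 2 1) expn1.
  by apply: leq_mul; rewrite ?leq_exp2r ?(leq_trans sS) ?(leq_trans sP) ?leq_addr ?leq_addl.
- have sD' := leq_trans sD (leq_addr #|` prodset A| _).
  have sQ' := leq_trans sQ (leq_addl #|` diffset A| _).
  have := product_difference_bound hK uB uD uP uQ B0 P0 BP BD BQ L0 BL DL sP2 n0.
  case=> h; [apply: Or31|apply: Or32|apply: Or33].
  + apply: (@absorb N (size B) 2 1 L 1 _ _ _ _ isT isT L0 isT hN e3 C3).
    by apply: leq_trans h _; rewrite !expn1 leq_mul2l sQ' orbT.
  + apply: (@absorb N (size B) 4 3 L 5 _ _ _ _ isT isT L0 isT hN e4 C4).
    by apply: leq_trans h _; apply: leq_mul; rewrite ?leq_exp2r.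
  + apply: (@absorb N (size B) 18 14 L 8 _ _ _ _ isT isT L0 isT hN e5 C5).
    apply: leq_trans h _; apply: leq_mul; first exact: leqnn.
    by rewrite (expnD _ 6 8); apply: leq_mul; rewrite leq_exp2r.
- apply: (@absorb N (size B) 4 3 L 1 _ _ _ _ isT isT L0 isT hN e2 C2).
  apply: leq_trans (product_energy uB uP B0 BP uQ BQ) _.
  apply: leq_trans (leq_mul (leqnn _) hE) _.
  rewrite (_ : size Q * (64 * (L * size S ^ 2)) = 64 * L ^ 1 * (size S ^ 2 * size Q));
    last by ring.
  apply: leq_mul; first exact: leqnn.
  rewrite (expnD _ 2 1) expn1.
  by apply: leq_mul; rewrite ?leq_exp2r ?(leq_trans sS) ?(leq_trans sQ) ?leq_addr ?leq_addl.
Qed.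

(** * From integer powers to real exponents *)

Local Open Scope fset_scope.
Local Open Scope ring_scope.

(** Compares $q$-th powers, using $N^{\alpha q}\le N^p$, and trades [L] for a multiple of the
    logarithm. *)
Lemma power_to_real (R : realType) (N M L p q Cc : nat) (alpha c1 : R) :
  (0 < q)%N -> (1 < N)%N -> (0 < Cc)%N -> 0 < c1 ->
  alpha * q%:R <= p%:R -> L%:R <= c1 * ln N%:R ->
  (N ^ p <= (Cc * L ^ 9 * M) ^ q)%N ->
  (Cc%:R * c1 ^+ 9)^-1 * (N%:R `^ alpha) * (ln N%:R `^ (- 9)) <= M%:R.
Proof.
move=> q0 N1 C0 c0 hpq hL h.
have lN : 0 < ln (N%:R : R) by rewrite ln_gt0 // ltr1n.
have N0 : (0 : R) <= N%:R by rewrite ler0n.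
have C0' : 0 < Cc%:R * c1 ^+ 9 by rewrite mulr_gt0 ?exprn_gt0 ?ltr0n.
have h1 : N%:R `^ alpha <= (Cc * L ^ 9 * M)%:R.
  rewrite -(ler_pXn2r q0) ?nnegrE ?powR_ge0 ?ler0n //.
  rewrite -powR_mulrn ?powR_ge0 // -powRrM.
  apply: (@le_trans _ _ (N%:R `^ p%:R)).
    by apply: ler_powR => //; rewrite ler1n ltnW.
  by rewrite powR_mulrn // -!natrX ler_nat.
have h2 : N%:R `^ alpha <= Cc%:R * c1 ^+ 9 * ln N%:R ^+ 9 * M%:R.
  apply: le_trans h1 _; rewrite [(_ * M)%:R]natrM [(Cc * _)%:R]natrM natrX.
  rewrite ler_wpM2r // -mulrA ler_wpM2l //.
  by rewrite -exprMn lerXn2r // ?nnegrE ?mulr_ge0 // ltW.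
rewrite powRN powR_mulrn ?(ltW lN) //.
rewrite mulrAC -invfM mulrC ler_pdivrMr ?mulr_gt0 ?exprn_gt0 ?ltr0n //.
by rewrite mulrC.
Qed.

Lemma ln_log2_bound (R : realType) (N : nat) : (1 < N)%N ->
  (2 * (trunc_log 2 N).+1)%N%:R <= 4 / ln 2 * ln N%:R :> R.
Proof.
move=> N1; have l2 : 0 < ln (2 : R) by rewrite ln_gt0 // ltr1n.
have /andP[lo _] := trunc_log_bounds (isT : (1 < 2)%N) (ltnW N1 : (0 < N)%N).
have t1 : (0 < trunc_log 2 N)%N by rewrite trunc_log_gt0.
rewrite mulrAC ler_pdivlMr //.
apply: (@le_trans _ _ (4 * ((trunc_log 2 N)%:R * ln 2))).
  (* With $\ell$ the truncated logarithm, $2(\ell+1)\le4\ell$ because $\ell\ge1$. *)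
  by rewrite mulrA (ler_wpM2r (ltW l2)) // -natrM ler_nat; lia.
rewrite ler_wpM2l // mulr_natl -lnXn // -natrX.
by rewrite ler_ln ?posrE ?ltr0n ?expn_gt0 // ?ler_nat // ltnW.
Qed.

Theorem theorem1p1 (R : realType) :
  exists c C : R, 0 < c /\ 0 <= C /\
    forall A : {fset R[i]}, (2 <= #|` A|)%N ->
      [/\ c * (#|` A|%:R `^ (1 + 9 / 31)) * (ln #|` A|%:R `^ (- C))
            <= (#|` diffset A| + #|` ratioset A|)%:R,
          c * (#|` A|%:R `^ (1 + 15 / 53)) * (ln #|` A|%:R `^ (- C))
            <= (#|` sumset A| + #|` ratioset A|)%:R,
          c * (#|` A|%:R `^ (1 + 11 / 39)) * (ln #|` A|%:R `^ (- C))
            <= (#|` diffset A| + #|` prodset A|)%:R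
        & c * (#|` A|%:R `^ (1 + 19 / 69)) * (ln #|` A|%:R `^ (- C))
            <= (#|` sumset A| + #|` prodset A|)%:R].
Proof.
have l2 : 0 < ln (2 : R) by rewrite ln_gt0 // ltr1n.
have c0 : 0 < 4 / ln (2 : R) by rewrite divr_gt0.
have [Cc [C0 hC]] := sum_product_nat R.
exists (Cc%:R * (4 / ln 2) ^+ 9)^-1, 9; split.
  by rewrite invr_gt0 mulr_gt0 ?ltr0n // exprn_gt0.
split=> // A A2; have [h1 h2 h3 h4] := hC A A2; have hL := ln_log2_bound R A2.
split.
(* The exponents compare as $22/17>40/31$, $4/3>68/53$, $\min(2,4/3,18/14)>50/39$ and
   $4/3>88/69$. *)
- by apply: power_to_real h1 => //; lra.
- by apply: power_to_real h2 => //; lra.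
- by case: h3 => h3; apply: power_to_real h3 => //; lra.
- by apply: power_to_real h4 => //; lra.
Qed.
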